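(* Let $B$ be a canonical Blaschke product of degree $d$, that is, $B(z)=z\prod_{k=1}^{d-1}\frac{z-a_k}{1-\overline{a_k}z}$ with $a_1,\dots,a_{d-1}\in\mathbb{D}$. Let $E_B$ be the exterior curve associated with $B$, let $I_B$ be the interior curve associated with $B$, and let $E_B^*$ be the dual curve of the homogenized exterior curve $E_B$. Let $u_B^*(z)=0$ be a defining equation of the affine part of $E_B^*$. Then the interior curve is given by $$I_B:\quad u_B^*(-z)=0 .$$
   Context: $\mathbb{D}$ is the open unit disk in $\mathbb{C}$ and $\partial\mathbb{D}$ the unit circle. A canonical Blaschke product $B$ of degree $d$ has, for every $\lambda\in\partial\mathbb{D}$, exactly $d$ distinct preimages $B^{-1}(\lambda)=\{z_1,\dots,z_d\}\subset\partial\mathbb{D}$. Interior curve: for $\lambda\in\partial\mathbb{D}$ let $\ell_\lambda$ be the set of all lines joining $z_j$ and $z_k$ for $j\ne k$, where $z_1,\dots,z_d$ are the points of $B^{-1}(\lambda)$. The interior curve $I_B$ is the envelope of the family of lines $\mathcal{L}_B=\{\ell_\lambda\}_{\lambda\in\partial\mathbb{D}}$, i.e. the curve whose family of tangent lines is the family of all lines occurring in $\mathcal{L}_B$. Exterior curve: for $\lambda\in\partial\mathbb{D}$ let $L_\lambda$ be the set of the $d$ lines tangent to $\partial\mathbb{D}$ at the $d$ points of $B^{-1}(\lambda)$. The exterior curve $E_B$ is the trace (set) of the intersection points of each two distinct elements of $L_\lambda$, as $\lambda$ ranges over $\partial\mathbb{D}$ (the intersection point of the tangents at $z_j,z_k$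 is the point at infinity exactly when $z_j+z_k=0$). It is an algebraic curve of degree at most $d-1$ in the real plane $\mathbb{C}\cong\mathbb{R}^2$, with defining equation in $z,\overline z$ $$\sum_{N=1}^{d}\sum_{K=0}^{N-1}(-1)^{d-N+K}\big(\sigma_{d-N}\overline{\sigma_K}-\overline{\sigma_N}\sigma_{d-K}\big)z^K\overline{z}^{\,d-N}H_{N-K-1}(z\overline z)=0,$$ where $\sigma_k$ is the elementary symmetric polynomial of degree $k$ in $a_1,\dots,a_{d-1}$ ($\sigma_0=1$, $\sigma_d=0$) and $H_n(t)=\sum_{0\le j\le n/2}(-1)^j\binom{n-j}{j}2^{n-2j}t^j$. Projective conventions: $\mathbb{C}$ is identified with the affine part of $\mathbb{P}_2(\mathbb{R})$ via $x+iy\leftrightarrow(x:y:1)$, and a curve in $\mathbb{C}$ is homogenized by homogenizing its defining polynomial in $x,y$. For a curve $C\subset\mathbb{P}_2(\mathbb{R})$ the dual curve is $C^*=\{L\in\mathbb{P}_2^*(\mathbb{R}) : L \text{ is a line tangent to } C \text{ at some } p\in C\}$, where the line $\{aX+bY+cW=0\}$ is identified with the point $(a:b:c)\in\mathbb{P}_2^*(\mathbb{R})$. The affine part of $\mathbb{P}_2^*(\mathbb{R})$ is identified with $\mathbb{C}$ by $(a:b:1)\leftrightarrow a+ib$. A defining equation ''$u(z)=0$'' means a real polynomial equation in $x,y$ (equivalently in $z,\overline z$) with $z=x+iy$; $u(-z)$ means replacing $z$ by $-z$ (and $\overline z$ by $-\overline z$). *)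

(* Defs.v *)
(* MathComp / MathComp-Analysis, over an arbitrary [R : realType]; the complex
   plane is [R[i]] from mathcomp-real-closed. *)
From mathcomp Require Import all_boot all_order all_algebra.
From mathcomp Require Import all_classical all_reals all_analysis.
From mathcomp Require Import complex.
(* Without its notations, which clash with those of analysis. *)
From mathcomp Require Import -(notations) mpoly.

Set Implicit Arguments.
Unset Strict Implicit.
Unset Printing Implicit Defensive.

Import Order.TTheory GRing.Theory Num.Theory.
Import numFieldNormedType.Exports.

Local Open Scope classical_set_scope.
Local Open Scope ring_scope.

Section BlaschkeCurves.
Variable R : realType.
Local Notation C := R[i].

Definition blaschke (n : nat) (a : 'I_n -> C) (z : C) : C :=
  z * \prod_(k < n) ((z - a k) / (1 - (a k)^*%C * z)).

Definition circle_fiber (B : C -> C) (lam : C) : set C :=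
  [set z | `|z| = 1 /\ B z = lam].

Definition expi (t : R) : C := (cos t +i* sin t)%C.

(* Points and lines of the real projective plane are given by their nonzero
   homogeneous coordinate vectors; a subset of the plane, or of the dual plane,
   is a set of nonzero vectors that is stable under nonzero scaling. *)

Definition hcoord (x y w : R) : 'rV[R]_3 := \row_(i < 3) [:: x; y; w]`_i.

Definition hpoint (z : C) : 'rV[R]_3 := hcoord (complex.Re z) (complex.Im z) 1.

(* The point [v] lies on the line [L]; the relation is symmetric, and vectors
   orthogonal to [L] are also used as directions. *)
Definition incident (L v : 'rV[R]_3) : Prop := \sum_(i < 3) L 0 i * v 0 i = 0.

(* (a : b : 1) <-> a + i b, both for points and for lines. *)
Definition affine_part (D : set 'rV[R]_3) : set C := [set z | D (hpoint z)].

(* The tangent to the unit circle at [z] is Re(z) X + Im(z) Y - W = 0. *)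
Definition circle_tangent (z : C) : 'rV[R]_3 :=
  hcoord (complex.Re z) (complex.Im z) (-1).

(* The trace of the intersection points, in the projective plane: the tangents
   at [z1] and [- z1] contribute their common point at infinity. *)
Definition exterior_curve (B : C -> C) : set 'rV[R]_3 :=
  [set v | v != 0 /\ exists lam z1 z2,
    [/\ `|lam| = 1, circle_fiber B lam z1, circle_fiber B lam z2, z1 != z2
      & incident (circle_tangent z1) v /\ incident (circle_tangent z2) v]].

Definition homogeneous (G : mpoly 3 R) : Prop :=
  exists k : nat, G \is ishomog1 k (@mdeg 3).

Definition vanishes_on (G : mpoly 3 R) (D : set 'rV[R]_3) : Prop :=
  forall v, D v -> meval (fun i => v 0 i) G = 0.

(* The projective algebraic curve cut out by the homogeneous equations of [D]
   (the projective Zariski closure).  Since [exterior_curve] contains the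
   intersection points at infinity, the line at infinity is a component of its
   homogenization exactly when the tangents at antipodal points contribute it,
   namely when [B] is even. *)
Definition homogenization (D : set 'rV[R]_3) : set 'rV[R]_3 :=
  [set v | v != 0 /\ forall G, homogeneous G -> vanishes_on G D ->
    meval (fun i => v 0 i) G = 0].

(* [L] is the tangent line of [D] at [p]: it coincides with the Zariski tangent
   space, the common kernel of the differentials at [p] of the forms vanishing
   on [D] ([p] is then a regular point).  The homogenization of the exterior
   curve of a Blaschke product of degree d has no singular real point: every
   real line through the origin meets this curve, of degree d - 1, in d - 1
   distinct real points. *)
Definition tangent_line (D : set 'rV[R]_3) (p L : 'rV[R]_3) : Prop :=
  L != 0 /\ forall v, incident L v <->
    (forall G, homogeneous G -> vanishes_on G D ->
       \sum_(i < 3) meval (fun j => p 0 j) (mderiv i G) * v 0 i = 0).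

Definition dual_curve (D : set 'rV[R]_3) : set 'rV[R]_3 :=
  [set L | exists2 p, D p & tangent_line D p L].

Definition chord_lines (B : C -> C) (lam : C) : set 'rV[R]_3 :=
  [set L | L != 0 /\ exists z1 z2,
    [/\ circle_fiber B lam z1, circle_fiber B lam z2, z1 != z2,
        incident L (hpoint z1) & incident L (hpoint z2)]].

(* Envelope of a family of lines F(lam), |lam| = 1, each F(lam) being a set of
   lines.  With lam = e^(it) and [l s] in F(e^(is)) a selection near [t] that is
   differentiable at [t], the characteristic points of the line [l t] are the
   solutions of the equations l(t).p = 0 and l'(t).p = 0.  Rescaling [l] by a
   differentiable factor does not change them. *)
Definition envelope (F : C -> set 'rV[R]_3) : set C :=
  [set p | exists t (l : R -> 'rV[R]_3) (dl : 'rV[R]_3),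
    [/\ \forall s \near t, F (expi s) (l s),
        forall i, is_derive t (1 : R) (fun s => l s 0 i) (dl 0 i),
        incident (l t) (hpoint p)
      & incident dl (hpoint p)]].

Definition interior_curve (B : C -> C) : set C := envelope (chord_lines B).

(* A real polynomial in x and y, as a function of z = x + i y. *)
Definition peval (u : mpoly 2 R) (z : C) : R :=
  meval (fun j : 'I_2 => [:: complex.Re z; complex.Im z]`_j) u.

Definition zariski_closure (A : set C) : set C :=
  [set z | forall p : mpoly 2 R,
    (forall w, A w -> peval p w = 0) -> peval p z = 0].

(* "f(z) = 0 is an equation of A", as an equality of point sets ... *)
Definition equation_of (f : C -> R) (A : set C) : Prop :=
  A = [set z | f z = 0].

(* ... and for [A] regarded as a real algebraic set.  The two differ when the
   Zariski closure of the trace has additional, isolated, real points. *)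
Definition algebraic_equation_of (f : C -> R) (A : set C) : Prop :=
  zariski_closure A = [set z | f z = 0].

End BlaschkeCurves.

(* Main.v *)
Require Import Defs.
From mathcomp Require Import all_boot all_order all_algebra.
From mathcomp Require Import all_classical all_reals all_analysis.
From mathcomp Require Import complex separable.
From mathcomp Require Import -(notations) mpoly.
From mathcomp Require Import ring lra zify.
Import Order.TTheory GRing.Theory Num.Theory.
Import numFieldNormedType.Exports.
Local Open Scope classical_set_scope.
Local Open Scope ring_scope.

Set Implicit Arguments.
Unset Strict Implicit.
Unset Printing Implicit Defensive.

(* Let [E] be the exterior curve and [n] the number of zeros of [B].  The pole of
   a chord [L] of the circle is the point of intersection of the tangents at its
   ends, so [E] is the image of the set of chords joining two points of a fiber
   under the polarity with respect to the unit circle, and a differentiable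
   family of such chords becomes a differentiable curve on [E].  The point [p]
   is characteristic for the family at [t] when the line of coordinates [- p]
   contains both the point and the velocity of this curve at [t], that is, when
   it is the tangent line of [E] there.
   This needs that [E] is its own homogenization and is smooth.  Writing
   [B = P / Q], a form [G] of degree [n] vanishing on [E] is obtained by
   expressing the symmetric polynomial [(P(z) Q(w) - P(w) Q(z)) / (z - w)] in
   [z + w] and [z w], which are rational in the coordinates of the pole.  On
   [S^1], [B (e^(i s)) = e^(i (psi s))] with [psi] increasing by [2 pi (n + 1)]
   over a period, so by the intermediate value theorem every line through the
   origin has [n] distinct finite points on [E].  Hence [G] has no other zeros,
   and these are simple: the derivative of [G] along the line does not vanish. *)

(** * Polarity with respect to the unit circle *)

Definition cross (R : realType) (u v : 'rV[R]_3) : 'rV[R]_3 :=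
  hcoord (u 0 1 * v 0 2 - u 0 2 * v 0 1) (u 0 2 * v 0 0 - u 0 0 * v 0 2)
    (u 0 0 * v 0 1 - u 0 1 * v 0 0).

(* The polarity with respect to the unit circle: the pole of the line [L] is
   [pole L], and conversely. *)
Definition pole (R : realType) (u : 'rV[R]_3) : 'rV[R]_3 :=
  hcoord (u 0 0) (u 0 1) (- u 0 2).

Section ProjectivePlane.
Variable R : realType.
Local Notation C := R[i].
Implicit Types (u v w L : 'rV[R]_3) (z : C).

Lemma sum_ord3 (F : 'I_3 -> R) : \sum_i F i = F 0 + F 1 + F 2.
Proof.
rewrite !big_ord_recr big_ord0 /= add0r.
by congr (F _ + F _ + F _); apply: val_inj.
Qed.

Lemma forall_ord3 (P : 'I_3 -> Prop) : P 0 -> P 1 -> P 2 -> forall i, P i.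
Proof.
move=> P0 P1 P2 [[|[|[|//]]] hi];
  [move: P0|move: P1|move: P2]; congr P; exact: val_inj.
Qed.

Lemma eq_row3 u v :
  u 0 0 = v 0 0 -> u 0 1 = v 0 1 -> u 0 2 = v 0 2 -> u = v.
Proof. by move=> h0 h1 h2; apply/rowP; exact: forall_ord3. Qed.

Lemma hcoordE (x y w : R) : (hcoord x y w 0 0 = x) * (hcoord x y w 0 1 = y)
  * (hcoord x y w 0 2 = w).
Proof. by rewrite !mxE. Qed.

Lemma incidentE L v :
  incident L v <-> L 0 0 * v 0 0 + L 0 1 * v 0 1 + L 0 2 * v 0 2 = 0.
Proof. by rewrite /incident sum_ord3. Qed.

Lemma incidentC L v : incident L v <-> incident v L.
Proof. by rewrite !incidentE; split=> <-; ring. Qed.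

Lemma incidentZr c L v : incident L v -> incident L (c *: v).
Proof. by rewrite !incidentE !mxE => h; rewrite -(mulr0 c) -h; ring. Qed.

Lemma polekC u : pole (pole u) = u.
Proof. by apply: eq_row3; rewrite !hcoordE ?opprK. Qed.

Lemma incident_pole L v : incident (pole L) v <-> incident L (pole v).
Proof. by rewrite !incidentE !hcoordE; split=> <-; ring. Qed.

Lemma pole_eq0 u : (pole u == 0) = (u == 0).
Proof.
apply/eqP/eqP => [/rowP h|->]; last by apply: eq_row3; rewrite !hcoordE !mxE ?oppr0.
move: (h 0) (h 1) (h 2); rewrite !hcoordE !mxE => h0 h1 /eqP.
by rewrite oppr_eq0 => /eqP h2; apply: eq_row3; rewrite !mxE.
Qed.

Lemma poleZ c u : pole (c *: u) = c *: pole u.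
Proof. by apply: eq_row3; rewrite !(hcoordE, mxE) /= ?mulrN. Qed.

Lemma incident_crossl u v : incident (cross u v) u.
Proof. by rewrite incidentE !hcoordE; ring. Qed.

Lemma incident_crossr u v : incident (cross u v) v.
Proof. by rewrite incidentE !hcoordE; ring. Qed.

Lemma cross_eq0_scale u v : v != 0 -> cross u v = 0 -> exists c, u = c *: v.
Proof.
move=> v0 /rowP h; move: (h 0) (h 1) (h 2); rewrite !hcoordE !mxE => h0 h1 h2.
have [i vi0] : exists i, v 0 i != 0.
  apply: contrapT => /forallNP hv; case/eqP: v0; apply/rowP => i.
  by rewrite mxE; apply/eqP/negPn/negP/hv.
exists (u 0 i / v 0 i); move: i vi0; apply: forall_ord3 => vi0;
  apply: eq_row3; rewrite !mxE; apply: (mulIf vi0); rewrite mulrAC divfK //; lra.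
Qed.

(** By the triple product identity, [cross w (cross u v)] is a combination of [u] and [v] whose
    coefficients are, up to sign, the two incidence sums, so it vanishes. *)
Lemma incident_cross u v w : cross u v != 0 -> incident w u -> incident w v ->
  exists c, w = c *: cross u v.
Proof.
move=> uv0; rewrite !incidentE => wu wv; apply: cross_eq0_scale => //.
have h i : u 0 i * (w 0 0 * v 0 0 + w 0 1 * v 0 1 + w 0 2 * v 0 2)
  - v 0 i * (w 0 0 * u 0 0 + w 0 1 * u 0 1 + w 0 2 * u 0 2) = 0.
  by rewrite wu wv !mulr0 subrr.
apply: eq_row3; rewrite !hcoordE !mxE; [rewrite -(h 0)|rewrite -(h 1)|rewrite -(h 2)];
  ring.
Qed.

Lemma incident2_scale u v w L : cross u v != 0 -> L != 0 ->
  incident L u -> incident L v -> incident w u -> incident w v ->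
  exists c, w = c *: L.
Proof.
move=> uv0 L0 Lu Lv wu wv.
have [c wE] := incident_cross uv0 wu wv; have [b LE] := incident_cross uv0 Lu Lv.
have b0 : b != 0 by apply: contra_neq L0 => b0; rewrite LE b0 scale0r.
by exists (c / b); rewrite LE scalerA divfK.
Qed.

Lemma hpoint_neq0 z : hpoint z != 0.
Proof.
by apply/eqP => /rowP /(_ 2); rewrite hcoordE mxE => /eqP; rewrite oner_eq0.
Qed.

Lemma cross_hpoint_neq0 (z1 z2 : C) : z1 != z2 -> cross (hpoint z1) (hpoint z2) != 0.
Proof.
apply: contra_neq => /rowP h; move: (h 0) (h 1).
rewrite !hcoordE !mxE; case: z1 z2 {h} => [x1 y1] [x2 y2] /= h0 h1.
by congr Complex; lra.
Qed.

(* Duality pairs the affine line of coordinates [z] with [1], the polarity with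
   [- 1]: this is the origin of the sign in [u (- z)]. *)
Lemma incident_hpointN z v : incident (hpoint (- z)) v <-> incident (pole v) (hpoint z).
Proof.
rewrite !incidentE !hcoordE; case: z => x y /=.
by split=> h; apply/eqP; rewrite -oppr_eq0; apply/eqP; rewrite -h; ring.
Qed.

Lemma circle_tangent_pole z : circle_tangent z = pole (hpoint z).
Proof. by apply: eq_row3; rewrite !hcoordE. Qed.

Lemma exterior_curveP (B : C -> C) v : exterior_curve B v <->
  exists lam, `|lam| = 1 /\ chord_lines B lam (pole v).
Proof.
split=> [[v0 [lam [z1 [z2 [lam1 h1 h2 z12]]]]]|[lam [lam1]]].
  rewrite !circle_tangent_pole => -[i1 i2].
  exists lam; split=> //; split; first by rewrite pole_eq0.
  by exists z1, z2; split=> //; apply/incidentC; apply/incident_pole.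
move=> [v0 [z1 [z2 [h1 h2 z12 i1 i2]]]]; split; first by rewrite -pole_eq0.
exists lam, z1, z2; split=> //; rewrite !circle_tangent_pole.
by split; apply/incident_pole; apply/incidentC.
Qed.

End ProjectivePlane.

(** * Reflection through the origin *)

Section Reflection.
Variable R : realType.
Local Notation C := R[i].

Lemma pevalN_ex (p : mpoly 2 R) : exists q : mpoly 2 R, forall z : C, peval q z = peval p (- z).
Proof.
exists (comp_mpoly [tuple (- mpolyX R (mnm1 i)) | i < 2] p) => z.
rewrite /peval comp_mpoly_meval; apply: meval_eq => i.
rewrite tnth_mktuple mevalN mevalXU; case: z => x y.
by case: i => [[|[|//]] hi].
Qed.

(** Replacing [z] by [- z] is an involution of the real polynomials, so it commutes with taking the
    closure. *)
Lemma zariski_closureN (A : set C) :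
  zariski_closure [set z | A (- z)] = [set z | zariski_closure A (- z)].
Proof.
apply/seteqP; split=> z /= h p hp; have [q hq] := pevalN_ex p.
  rewrite -hq; apply: h => w /= Aw; rewrite hq; exact: hp.
rewrite -(opprK z) -hq; apply: h => w Aw; rewrite hq.
by apply: hp; rewrite /= opprK.
Qed.

End Reflection.

(** * Lifts of circle maps *)

Section CircleLift.
Variable R : realType.
Local Notation C := R[i].
Implicit Types (z a : C) (s t : R).

Lemma complexP z1 z2 : complex.Re z1 = complex.Re z2 -> complex.Im z1 = complex.Im z2 -> z1 = z2.
Proof. by case: z1 z2 => [x1 y1] [x2 y2] /= -> ->. Qed.

Lemma expiD s t : expi (s + t) = expi s * expi t.
Proof. by rewrite /expi cosD sinD; apply: complexP => /=; ring. Qed.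

Lemma expi_sum (I : finType) (f : I -> R) :
  expi (\sum_i f i) = \prod_i expi (f i).
Proof.
apply: (big_morph _ expiD); by rewrite /expi cos0 sin0.
Qed.

Lemma conj_expi t : (expi t)^*%C = expi (- t).
Proof. by rewrite /expi cosN sinN. Qed.

Lemma norm_complex_eq1 z : `|z| = 1 <-> complex.Re z ^+ 2 + complex.Im z ^+ 2 = 1.
Proof.
have e : (complex.Re z ^+ 2 + complex.Im z ^+ 2)%:C%C = `|z| ^+ 2 by exact: add_Re2_Im2.
split=> [h|h]; first by apply: complexI; rewrite e h expr1n.
by apply/eqP; rewrite -(eqrXn2 (n := 2)) // expr1n -e h.
Qed.

Lemma norm_expi t : `|expi t| = 1.
Proof. by apply/norm_complex_eq1; rewrite /= cos2Dsin2. Qed.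

Lemma expi_surj z : `|z| = 1 -> exists t, z = expi t.
Proof.
case: z => x y /norm_complex_eq1 /= xy.
have x1 : -1 <= x <= 1 by apply/andP; nra.
have hc : cos (acos x) = x by rewrite acosK // in_itv.
have hs : sin (acos x) = `|y|.
  by rewrite sin_acos // -sqrtr_sqr -xy; congr Num.sqrt; ring.
have [y0|y0] := leP 0 y; [exists (acos x)|exists (- acos x)].
  by apply: complexP; rewrite /= ?hc ?hs ?ger0_norm.
by apply: complexP; rewrite /= ?cosN ?sinN ?hc ?hs ?ltr0_norm ?opprK.
Qed.

Lemma norm_lt1 z : `|z| < 1 -> complex.Re z ^+ 2 + complex.Im z ^+ 2 < 1.
Proof.
move=> z1; rewrite -ltcR (add_Re2_Im2 z : _ = _).
by rewrite exprn_ilt1.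
Qed.

(** The argument of [1 + i h] is [atan h], and rotation by minus twice the argument sends a number
    to its conjugate. *)
Lemma expi_Natan2 (h : R) : (1 +i* h)%C * expi (- (2 * atan h)) = (1 -i* h)%C.
Proof.
have c0 : cos (atan h) != 0 by rewrite cos_atan invr_eq0 gt_eqF // sqrtr_gt0; nra.
have -> : h = sin (atan h) / cos (atan h) by rewrite -{1}(atanK h).
set t := atan _; have -> : - (2 * atan (sin (atan h) / cos (atan h))) = - (atan h + atan h).
  by rewrite -/(tan (atan h)) atanK; ring.
have -> : - (atan h + atan h) = (- atan h) + (- atan h) by ring.
rewrite expiD -!conj_expi /expi.
have := cos2Dsin2 (atan h); move: c0; set c := cos _; set d := sin _ => c0 cd.
apply: complexP => /=.
  by transitivity (c ^+ 2 + d ^+ 2) => //; field.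
by transitivity (- (d / c) * (c ^+ 2 + d ^+ 2)); [field|rewrite cd mulr1].
Qed.


(* [psi] lifts the circle map [f], of degree [k], to the universal cover. *)
Definition circle_lift (k : R) (f : C -> C) (psi : R -> R) :=
  [/\ forall t, f (expi t) = expi (psi t),
      forall t, exists2 D, 0 < D & is_derive t (1 : R) psi D
    & forall t, psi (t + pi *+ 2) = psi t + pi *+ 2 * k].

(** On the circle [z - a] is [z] times the conjugate of [w = 1 - a^* z], and [w] has positive real
    part [1 - X]. Hence [t - 2 arg w] is a lift, and [arg w = atan h] involves no choice of
    branch. *)
Lemma mobius_lift a : `|a| < 1 ->
  exists psi, circle_lift 1 (fun z => (z - a) / (1 - a^*%C * z)) psi.
Proof.
move=> /norm_lt1; case: a => p q /=; set rho := _ + _ => rho1.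
pose X t := p * cos t + q * sin t; pose Y t := p * sin t - q * cos t.
have XY t : X t ^+ 2 + Y t ^+ 2 = rho.
  rewrite -[RHS]mulr1 -(cos2Dsin2 t) /X /Y /rho; ring.
have X1 t : 0 < 1 - X t by have := XY t; nra.
pose h t := - Y t / (1 - X t).
have wE t : 1 - (p -i* q)%C * expi t = (1 - X t)%:C%C * (1 +i* h t)%C.
  have := X1 t => /lt0r_neq0 x0.
  by apply: complexP; rewrite /= /h /X /Y; [ring|field].
have cE t : expi t - (p +i* q)%C = (1 - X t)%:C%C * (1 -i* h t)%C * expi t.
  have := X1 t => /lt0r_neq0 x0.
  have e : (1 - X t)%:C%C * (1 -i* h t)%C = ((1 - X t) +i* Y t)%C.
    by apply: complexP; rewrite /= /h; [ring|field].
  rewrite e /X /Y /expi; have := cos2Dsin2 t; set c := cos t; set d := sin t => cd.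
  apply: complexP => /=.
    by transitivity (c - p * (c ^+ 2 + d ^+ 2)); [rewrite cd mulr1|ring].
  by transitivity (d - q * (c ^+ 2 + d ^+ 2)); [rewrite cd mulr1|ring].
exists (fun t => t - 2 * atan (h t)); split.
- move=> t; rewrite cE wE expiD -expi_Natan2.
  have x0 : (1 - X t)%:C%C != 0 by rewrite eq_complex /= (gt_eqF (X1 t)).
  have h0 : (1 +i* h t)%C != 0 by rewrite eq_complex /= oner_eq0.
  move: x0 h0; move: (1 - X t)%:C%C => u u0 h0.
  by field; rewrite h0.
(* The Poisson kernel of the disk, positive because [rho < 1]. *)
- move=> t; pose D := (1 - rho) / ((1 - X t) ^+ 2 + Y t ^+ 2).
  have w0 : 0 < (1 - X t) ^+ 2 + Y t ^+ 2 by have := X1 t; nra.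
  exists D; first by rewrite divr_gt0 // subr_gt0.
  have dX : is_derive t (1 : R) X (- Y t).
    by apply: is_derive_eq; rewrite /Y /GRing.scale /=; ring.
  have dY : is_derive t (1 : R) Y (X t).
    by apply: is_derive_eq; rewrite /X /GRing.scale /=; ring.
  have := X1 t => /lt0r_neq0 x0.
  have dV := @is_deriveV _ (cst 1 - X) t 1 _ x0 _.
  have dh : is_derive t (1 : R) h ((rho - X t) / (1 - X t) ^+ 2).
    by apply: is_derive_eq; rewrite /GRing.scale /= -(XY t); field.
  apply: is_derive_eq; rewrite /GRing.scale /= /D /h -(XY t).
  by field; rewrite x0 gt_eqF //=; have := w0; nra.
- move=> t; rewrite mulr1 /h /X /Y cosD2pi sinD2pi; ring.
Qed.

Lemma blaschke_lift n (a : 'I_n -> C) : (forall k, `|a k| < 1) ->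
  exists psi, circle_lift n.+1%:R (blaschke a) psi.
Proof.
move=> ha; have [psi hpsi] := choice (fun k => mobius_lift (ha k)).
exists (fun t => t + \sum_k psi k t); split.
- move=> t; rewrite expiD expi_sum /blaschke; congr (_ * _).
  by apply: eq_bigr => k _; have [-> _ _] := hpsi k.
- move=> t; have /choice [D hD] : forall k, exists D, 0 < D /\ is_derive t (1 : R) (psi k) D.
    by move=> k; have [_ /(_ t) [D D0 hD] _] := hpsi k; exists D.
  exists (1 + \sum_k D k).
    by rewrite ltr_pwDl // sumr_ge0 // => k _; have [/ltW] := hD k.
  have -> : (fun t => t + \sum_k psi k t) = id + \sum_k psi k.
    by apply/funext => x; rewrite /= fct_sumE.
  have hk k : is_derive t (1 : R) (psi k) (D k) by have [] := hD k.
  by apply: is_derive_eq.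
- move=> t; under eq_bigr => k _ do [case: (hpsi k) => _ _ ->].
  rewrite big_split /= sumr_const card_ord mulr1 -mulr_natr -natr1; ring.
Qed.

Section Lift.
Variables (k : R) (f : C -> C) (psi : R -> R).
Hypothesis hpsi : circle_lift k f psi.

Lemma circle_lift_continuous : continuous psi.
Proof.
move=> t; have [_ /(_ t) [D _ hD] _] := hpsi.
exact/differentiable_continuous/derivable1_diffP.
Qed.

Lemma circle_lift_ltr s t : s < t -> psi s < psi t.
Proof.
move=> st; have [_ hd _] := hpsi.
have [D hD] := choice (fun t => (let: ex_intro2 D h1 h2 := hd t in ex_intro _ D (conj h1 h2))).
have [|x _ e] := @MVT _ psi D s t st (fun x _ => (hD x).2).
  by apply: continuous_subspaceT; exact: circle_lift_continuous.
by rewrite -subr_gt0 e mulr_gt0 ?subr_gt0 //; have [] := hD x.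
Qed.

Lemma circle_lift_inj : injective psi.
Proof.
move=> s t e; have [/circle_lift_ltr|/circle_lift_ltr|//] := ltgtP s t;
  by rewrite e ltxx.
Qed.

Lemma circle_lift_periodn t n : psi (t + pi *+ 2 *+ n) = psi t + pi *+ 2 * k *+ n.
Proof.
have [_ _ hp] := hpsi.
elim: n => [|n ih]; first by rewrite !mulr0n !addr0.
by rewrite !(mulrSr _ n) [t + _]addrA hp ih -addrA.
Qed.

(** Each turn adds [pi *+ 2 * k] to [psi], so its values are unbounded on both sides and the
    intermediate value theorem applies. *)
Lemma circle_lift_surj : 0 < k -> forall y, exists t, psi t = y.
Proof.
move=> k0 y; pose c := pi *+ 2 * k.
have c0 : 0 < c by rewrite mulr_gt0 // mulrn_wgt0 // pi_gt0.
have [n hn] : exists n : nat, `|y| + `|psi 0| < c *+ n.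
  exists (Num.bound ((`|y| + `|psi 0|) / c)).
  by rewrite -mulr_natr -ltr_pdivrMl // mulrC archi_boundP // divr_ge0 ?addr_ge0 // ltW.
have h1 := circle_lift_periodn 0 n; rewrite add0r -/c in h1.
have h2 := circle_lift_periodn (- (pi *+ 2 *+ n)) n; rewrite addNr -/c in h2.
have [] := @IVT _ psi (- (pi *+ 2 *+ n)) (pi *+ 2 *+ n) y.
- by rewrite ge0_cp // mulrn_wge0 // mulrn_wge0 // pi_ge0.
- by apply: continuous_subspaceT; exact: circle_lift_continuous.
- have := ler_norm y; have := ler_norm (- y); rewrite normrN.
  have := ler_norm (psi 0); have := ler_norm (- psi 0); rewrite normrN => *.
  by rewrite ge_min le_max; apply/andP; split; apply/orP; [left|right]; lra.
- by move=> t _ ?; exists t.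
Qed.

(** Lets an end of a chord follow its fiber differentiably: [theta] is the inverse of [psi],
    precomposed with a translation. *)
Lemma circle_lift_section t0 s0 : 0 < k -> f (expi t0) = expi s0 ->
  exists theta (d : R), [/\ theta s0 = t0, is_derive s0 (1 : R) theta d
    & forall s, f (expi (theta s)) = expi s].
Proof.
move=> k0 h0; have [hf hd _] := hpsi.
have [g gK] := choice (circle_lift_surj k0).
have Kg : cancel psi g by move=> t; apply: circle_lift_inj; rewrite gK.
have [D D0 hD] := hd t0.
have dg : is_derive (psi t0) (1 : R) g D^-1.
  apply: is_derive_inverse => //; last by rewrite gt_eqF.
    by near=> x; exact: Kg.
  by near=> x; exact: circle_lift_continuous.
(* The shift [psi t0 - s0] is a multiple of [2 pi], since both angles represent [f (expi t0)]. *)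
exists (fun s => g (s + (psi t0 - s0))), (D^-1 * 1); split.
- by rewrite addrC subrK Kg.
- have e : s0 + (psi t0 - s0) = psi t0 by rewrite addrC subrK.
  apply: (@is_derive1_comp _ g (fun s => s + (psi t0 - s0))); first by rewrite e.
  exact: is_derive_shift.
- move=> s; rewrite hf gK addrCA expiD -hf h0 -expiD; congr expi; ring.
Unshelve. all: by end_near. Qed.

End Lift.

End CircleLift.

(** * The form defining the exterior curve *)

Section Lucas.
Variable S : comNzRingType.
Implicit Types (e f z w : S).

(* [lucas (z + w) (z * w) m] is [(z ^+ m - w ^+ m) / (z - w)]. *)
Fixpoint lucas e f (m : nat) {struct m} : S :=
  match m with
  | 0 => 0
  | m'.+1 => match m' with
    | 0 => 1
    | m''.+1 => e * lucas e f m' - f * lucas e f m''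
    end
  end.

Lemma lucasS e f m :
  lucas e f m.+2 = e * lucas e f m.+1 - f * lucas e f m.
Proof. by []. Qed.

Lemma nat_ind2 (P : nat -> Prop) : P 0%N -> P 1%N ->
  (forall m, P m -> P m.+1 -> P m.+2) -> forall m, P m.
Proof.
move=> P0 P1 PS m; suff: P m /\ P m.+1 by case.
by elim: m => // m [Pm PSm]; split=> //; exact: PS.
Qed.

Lemma lucas_sum_prod z w m :
  (z - w) * lucas (z + w) (z * w) m = z ^+ m - w ^+ m.
Proof.
elim/nat_ind2: m => [||m h1 h2]; rewrite ?mulr0 ?subrr // ?mulr1 //.
rewrite lucasS mulrBr [X in X - _]mulrCA [X in _ - X]mulrCA h1 h2 !exprS; ring.
Qed.

(** Weighted homogeneity, [e] having weight 1 and [f] weight 2; it serves to clear the denominators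
    of [z + w] and [z * w]. *)
Lemma lucas_scale c e f m :
  lucas (c * e) (c ^+ 2 * f) m.+1 = c ^+ m * lucas e f m.+1.
Proof.
elim/nat_ind2: m => [||m h1 h2]; first by rewrite mul1r.
  by rewrite !lucasS /=; ring.
by rewrite lucasS h1 h2 [in RHS]lucasS !exprS; ring.
Qed.

Lemma lucas_zero e m : lucas e 0 m.+1 = e ^+ m.
Proof.
by elim: m => // m ih; rewrite lucasS ih mul0r subr0 exprS.
Qed.

End Lucas.

Lemma rmorph_lucas (S T : comNzRingType) (g : {rmorphism S -> T}) e f m :
  g (lucas e f m) = lucas (g e) (g f) m.
Proof.
elim/nat_ind2: m => [||m h1 h2]; rewrite ?rmorph0 ?rmorph1 //.
by rewrite lucasS rmorphB !rmorphM h1 h2.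
Qed.

Lemma lucas_poly (S : comNzRingType) (b c : S) m (p := lucas (b *: 'X) c%:P m.+1) :
  (size p <= m.+1)%N /\ p`_m = b ^+ m.
Proof.
rewrite {}/p; elim/nat_ind2: m => [||m [s1 c1] [s2 c2]].
- by rewrite /= size_poly1 coef1.
- rewrite lucasS /= mulr1 mulr0 subr0 coefZ coefX mulr1; split=> //.
  by rewrite (leq_trans (size_scale_leq _ _)) // size_polyX.
- rewrite lucasS -scalerAl mul_polyC; split.
    rewrite (leq_trans (size_polyD _ _)) // geq_max size_polyN; apply/andP; split.
      rewrite (leq_trans (size_scale_leq _ _)) // (leq_trans (size_polyMleq _ _)) //.
      by rewrite size_polyX.
    by rewrite (leq_trans (size_scale_leq _ _)) // ltnW // ltnW.
  rewrite coefB !coefZ coefXM -[m.+2.-1]/m.+1 c2 [X in _ - _ * X]nth_default.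
    by rewrite mulr0 subr0 [RHS]exprS.
  by rewrite (leq_trans s1).
Qed.

(** * Real forms written in complex coordinates *)

Section Forms.
Variable R : realType.
Local Notation C := R[i].
Implicit Types (f g : 'rV[R]_3 -> R) (v : 'rV[R]_3).

(** Forms are handled as functions, so that they can be built from complex expressions whose real
    polynomial is never expanded. *)
Definition is_form k f := exists2 G : mpoly 3 R,
  G \is ishomog1 k (@mdeg 3) & forall v, meval (fun i => v 0 i) G = f v.

Lemma is_form_ext k f g : f =1 g -> is_form k f -> is_form k g.
Proof. by move=> fg [G hG Gf]; exists G => // v; rewrite Gf. Qed.

Lemma is_form0 k : is_form k (fun=> 0).
Proof. by exists 0; [exact: dhomog0|move=> v; rewrite meval0]. Qed.

Lemma is_form1 : is_form 0 (fun=> 1).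
Proof. by exists 1; [exact: dhomog1|move=> v; rewrite meval1]. Qed.

Lemma is_form_coord i : is_form 1 (fun v => v 0 i).
Proof.
exists (mpolyX R (mnm1 i)); first by rewrite dhomogX /= mdeg1.
by move=> v; rewrite mevalXU.
Qed.

Lemma is_formD k f g : is_form k f -> is_form k g -> is_form k (fun v => f v + g v).
Proof.
move=> [F hF Ff] [G hG Gg]; exists (F + G); first exact: dhomogD.
by move=> v; rewrite mevalD Ff Gg.
Qed.

Lemma is_formM k l f g : is_form k f -> is_form l g ->
  is_form (k + l) (fun v => f v * g v).
Proof.
move=> [F hF Ff] [G hG Gg]; exists (F * G); first exact: dhomogM.
by move=> v; rewrite mevalM Ff Gg.
Qed.

Lemma is_formZ k c f : is_form k f -> is_form k (fun v => c * f v).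
Proof.
move=> [F hF Ff]; exists (c *: F); first exact: dhomogZ.
by move=> v; rewrite mevalZ Ff.
Qed.

Lemma is_form_sum k (I : finType) (F : I -> 'rV[R]_3 -> R) :
  (forall i, is_form k (F i)) -> is_form k (fun v => \sum_i F i v).
Proof.
move=> hF; apply: (is_form_ext (f := \sum_i F i)) => [v|]; first by rewrite fct_sumE.
elim/big_ind : _ => //; [exact: is_form0|exact: is_formD].
Qed.

(** For a line this is a normal vector; a line and its pole share it. *)
Definition ncoord v : C := (v 0 0 +i* v 0 1)%C.
Definition nsqr v : R := v 0 0 ^+ 2 + v 0 1 ^+ 2.

Lemma ncoord_conj v : ncoord v * (ncoord v)^*%C = (nsqr v)%:C%C.
Proof. by apply: complexP; rewrite /= /nsqr; ring. Qed.

(** One factor is removed at a time by [Re ((x + i y) s) = x Re s + y Re (i s)] and its conjugate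
    analogue; the induction is over all [c] because [c] absorbs the factor [i]. *)
Lemma is_form_monomial j l c :
  is_form (j + l) (fun v => complex.Re (c * ncoord v ^+ j * (ncoord v)^*%C ^+ l)).
Proof.
elim: j c => [|j ihj] c; last first.
  apply: (is_form_ext (f := fun v =>
    v 0 0 * complex.Re (c * ncoord v ^+ j * (ncoord v)^*%C ^+ l) +
    v 0 1 * complex.Re (c * 'i%C * ncoord v ^+ j * (ncoord v)^*%C ^+ l))) => [v|].
    rewrite exprS; set s := _ ^+ j; set t := _ ^+ l.
    have -> : c * (ncoord v * s) * t = ncoord v * (c * s * t) by ring.
    have -> : c * 'i%C * s * t = 'i%C * (c * s * t) by ring.
    by case: (c * s * t) => x y /=; ring.
  by apply: is_formD; apply: (@is_formM 1); rewrite ?ihj //; exact: is_form_coord.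
elim: l c => [|l ihl] c.
  apply: (is_form_ext (f := fun v => complex.Re c * 1)) => [v|].
    by rewrite !mulr1.
  exact/is_formZ/is_form1.
apply: (is_form_ext (f := fun v =>
    v 0 0 * complex.Re (c * ncoord v ^+ 0 * (ncoord v)^*%C ^+ l) +
    v 0 1 * complex.Re (c * - 'i%C * ncoord v ^+ 0 * (ncoord v)^*%C ^+ l))) => [v|].
  rewrite !expr0 !mulr1 exprS; set t := _ ^+ l.
  have -> : c * ((ncoord v)^*%C * t) = (ncoord v)^*%C * (c * t) by ring.
  have -> : c * - 'i%C * t = - 'i%C * (c * t) by ring.
  by case: (c * t) => x y /=; ring.
by apply: is_formD; apply: (@is_formM 1); rewrite ?ihl //; exact: is_form_coord.
Qed.

(** At [v 0 2 = 1] this is the polynomial [H_m] of the equation of the exterior curve, evaluated at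
    [nsqr v]. *)
Lemma is_form_lucas m : is_form m (fun v => lucas (2 * v 0 2) (nsqr v) m.+1).
Proof.
elim/nat_ind2: m => [||m h1 h2]; first exact: is_form1.
  apply: (is_form_ext (f := fun v => 2 * v 0 2)) => [v|].
    by rewrite lucasS /=; ring.
  exact/is_formZ/is_form_coord.
apply: (is_form_ext (f := fun v => 2 * (v 0 2 * lucas (2 * v 0 2) (nsqr v) m.+2) +
   -1 * ((v 0 0 * v 0 0 + v 0 1 * v 0 1) * lucas (2 * v 0 2) (nsqr v) m.+1))) => [v|].
  by rewrite [RHS]lucasS /nsqr; ring.
have hc := is_form_coord; apply: is_formD; apply: is_formZ.
  exact: (@is_formM 1 m.+1).
by apply: (@is_formM 2 m) => //; apply: is_formD; exact: (@is_formM 1 1).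
Qed.

End Forms.

(** * The Bezoutian of two polynomials as a form in the pole *)

Section Bezoutian.
Variables (R : realType) (d : nat) (P Q : {poly R[i]}).
Local Notation C := R[i].
Hypotheses (sP : (size P <= d.+1)%N) (sQ : (size Q <= d.+1)%N).

(** Dividing [z ^+ k * w ^+ j - z ^+ j * w ^+ k] by [z - w] leaves, up to the sign,
    [(z * w) ^+ minn j k] times the [lucas] term of index [|k - j|]. Since [z * w] is [n] over its
    conjugate, multiplying by the power [d.-1] of this conjugate produces the exponents below. *)
Definition bezout_coef (n : C) (k j : nat) : C :=
  (-1) ^+ (k < j)%N * (P`_k * Q`_j) * n ^+ minn j k * n^*%C ^+ (d - maxn j k).

(* A homogeneous version of [(P(z) Q(w) - P(w) Q(z)) / (z - w)], a symmetric
   polynomial of [z] and [w], in which [z] and [w] are the roots of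
   [n^* X^2 - 2 v_2 X + n], the points where the polar of [v] meets the circle. *)
Definition bezout_form (v : 'rV[R]_3) : R :=
  \sum_(k < d.+1) \sum_(j < d.+1) complex.Re (bezout_coef (ncoord v) k j) *
     lucas (2 * v 0 2) (nsqr v) ((k - j) + (j - k)).

(** Off the diagonal the degrees [minn j k], [d - maxn j k] and [|k - j| - 1] add up to [d.-1]; on
    it [lucas] has index 0 and vanishes. *)
Lemma bezout_form_is_form : is_form d.-1 bezout_form.
Proof.
apply: is_form_sum => k; apply: is_form_sum => j.
have [->|kj] := eqVneq k j.
  by apply: is_form_ext (@is_form0 R _) => v; rewrite subnn mulr0.
have km := ltn_ord k; have jm := ltn_ord j.
have hm : ((k - j) + (j - k) = ((k - j) + (j - k)).-1.+1)%N.
  by rewrite prednK //; move: kj; rewrite -val_eqE /=; lia.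
rewrite hm; apply: (is_form_ext (f := fun v => complex.Re
  ((-1) ^+ (k < j)%N * (P`_k * Q`_j) * ncoord v ^+ minn j k * (ncoord v)^*%C ^+ (d - maxn j k))
  * lucas (2 * v 0 2) (nsqr v) ((k - j) + (j - k)).-1.+1)) => //.
have -> : (d.-1 = minn j k + (d - maxn j k) + ((k - j) + (j - k)).-1)%N.
  by move: kj; rewrite -val_eqE /=; lia.
by apply: is_formM; [exact: is_form_monomial|exact: is_form_lucas].
Qed.

Lemma bezout_formE (v : 'rV[R]_3) : bezout_form v =
  complex.Re (\sum_(k < d.+1) \sum_(j < d.+1) bezout_coef (ncoord v) k j *
     lucas (2 * v 0 2)%:C%C (ncoord v * (ncoord v)^*%C) ((k - j) + (j - k))).
Proof.
rewrite (raddf_sum (@complex.Re R : Rcomplex R -> R)); apply: eq_bigr => k _.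
rewrite (raddf_sum (@complex.Re R : Rcomplex R -> R)); apply: eq_bigr => j _.
rewrite ncoord_conj -(rmorph_lucas (real_complex R)).
by case: bezout_coef => x y /=; ring.
Qed.

Lemma bezout_term (n z w : C) (e : C) k j : (k <= d)%N -> (j <= d)%N ->
  n^*%C * (z + w) = e -> n^*%C * (z * w) = n ->
  (z - w) * (bezout_coef n k j * lucas e (n * n^*%C) ((k - j) + (j - k))) =
  n^*%C ^+ d.-1 * (P`_k * Q`_j) * (z ^+ k * w ^+ j - z ^+ j * w ^+ k).
Proof.
move=> kd jd <- nE; rewrite /bezout_coef; set b := n^*%C; set c := P`_k * Q`_j.
(* Here [l] is the smaller exponent and [l + m.+1] the larger; the case [k < j] follows by
   antisymmetry. *)
have aux l m : (l + m < d)%N ->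
    (z - w) * (c * n ^+ l * b ^+ (d - (l + m.+1)) * lucas (b * (z + w)) (n * b) m.+1) =
    b ^+ d.-1 * c * (z ^+ (l + m.+1) * w ^+ l - z ^+ l * w ^+ (l + m.+1)).
  move=> lm; have -> : n * b = b ^+ 2 * (z * w) by rewrite -nE; ring.
  rewrite lucas_scale -[in n ^+ l]nE.
  have -> : d.-1 = (l + (d - (l + m.+1)) + m)%N by lia.
  rewrite !exprMn !exprD.
  have := lucas_sum_prod z w m.+1; set L := lucas _ _ _ => hL.
  transitivity (b ^+ l * b ^+ (d - (l + m.+1)) * b ^+ m * c * (z ^+ l * w ^+ l) * ((z - w) * L)).
    ring.
  by rewrite hL; ring.
have [kj|jk|->] := ltngtP k j.
- have [m jE] : exists m, j = (k + m.+1)%N by exists (j - k).-1; lia.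
  have := aux k m; rewrite -jE.
  have -> : (k - j + (j - k) = m.+1)%N by lia.
  move=> h; have {}h := h ltac:(lia).
  transitivity (- (b ^+ d.-1 * c * (z ^+ j * w ^+ k - z ^+ k * w ^+ j))); last ring.
  by rewrite -h expr1; ring.
- have [m kE] : exists m, k = (j + m.+1)%N by exists (k - j).-1; lia.
  have := aux j m; rewrite -kE.
  have -> : (k - j + (j - k) = m.+1)%N by lia.
  by move=> <-; [rewrite expr0 mul1r|lia].
- by rewrite subnn mulr0 mulr0 subrr mulr0.
Qed.

(** Summing [bezout_term], the complex sum times [z - w] is a multiple of [P.[z] * Q.[w] - P.[w] *
    Q.[z]]. *)
Lemma bezout_form_eq0 (v : 'rV[R]_3) (z w : C) : z != w ->
  (ncoord v)^*%C * (z + w) = (2 * v 0 2)%:C%C -> (ncoord v)^*%C * (z * w) = ncoord v ->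
  P.[z] * Q.[w] = P.[w] * Q.[z] -> bezout_form v = 0.
Proof.
move=> zw h1 h2 hPQ; rewrite bezout_formE; set S := (X in complex.Re X).
suff -> : S = 0 by [].
have zw0 : z - w != 0 by rewrite subr_eq0.
apply: (mulfI zw0); rewrite mulr0 mulr_sumr.
transitivity ((ncoord v)^*%C ^+ d.-1 * (P.[z] * Q.[w] - P.[w] * Q.[z])); last first.
  by rewrite hPQ subrr mulr0.
rewrite !(horner_coef_wide _ sP) !(horner_coef_wide _ sQ) !big_distrlr /= -sumrB mulr_sumr.
apply: eq_bigr => k _; rewrite mulr_sumr -sumrB mulr_sumr; apply: eq_bigr => j _.
have kd := ltn_ord k; have jd := ltn_ord j.
by rewrite (bezout_term _ _ h1 h2) //; ring.
Qed.

Hypotheses (d0 : (0 < d)%N) (P0 : P`_0 = 0) (Pd : P`_d = 1) (Q0 : Q`_0 = 1).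

(** Varying the last coordinate describes a line through the origin; the exact degree bounds the
    number of zeros on it. *)
Lemma bezout_form_poly (x y : R) : exists p : {poly R},
  [/\ forall w, p.[w] = bezout_form (hcoord x y w), (size p <= d)%N & p`_d.-1 = 2 ^+ d.-1].
Proof.
pose n : C := (x +i* y)%C; pose N := x ^+ 2 + y ^+ 2.
pose L m : {poly R} := lucas (2 *: 'X) N%:P m.
have sL m : (m <= d)%N -> (size (L m) <= d)%N.
  case: m => [|m] md; first by rewrite size_poly0.
  by rewrite (leq_trans (lucas_poly _ _ m).1).
exists (\sum_(k < d.+1) \sum_(j < d.+1)
  complex.Re (bezout_coef n k j) *: L ((k - j) + (j - k))%N); split.
- move=> w; rewrite /bezout_form horner_sum; apply: eq_bigr => k _.
  rewrite horner_sum; apply: eq_bigr => j _; rewrite hornerZ /ncoord /nsqr !hcoordE.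
  congr (_ * _); rewrite -/(horner_eval w _) /L rmorph_lucas /= /horner_eval.
  by rewrite hornerZ hornerX hornerC.
- apply: (big_ind (fun p : {poly R} => size p <= d)%N); first by rewrite size_poly0.
    by move=> p q ? ?; rewrite (leq_trans (size_polyD _ _)) // geq_max; apply/andP.
  move=> k _; apply: (big_ind (fun p : {poly R} => size p <= d)%N); first by rewrite size_poly0.
    by move=> p q ? ?; rewrite (leq_trans (size_polyD _ _)) // geq_max; apply/andP.
  move=> j _; rewrite (leq_trans (size_scale_leq _ _)) // sL //.
  by have := ltn_ord k; have := ltn_ord j; lia.
(* Degree [d.-1] requires [|k - j| = d]. The pair [k = 0], [j = d] is killed by [P0], which leaves
   [k = d], [j = 0]. *)
rewrite coef_sum (bigD1 ord_max) //= [X in _ + X]big1 ?addr0 => [|k kd].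
  rewrite coef_sum (bigD1 ord0) //= [X in _ + X]big1 ?addr0 => [|j j0].
    rewrite coefZ /bezout_coef min0n max0n subnn Pd Q0 subn0 sub0n addn0 /= !mulr1 mul1r.
    have -> : L d = L d.-1.+1 by rewrite prednK.
    by rewrite (lucas_poly _ _ d.-1).2; ring.
  rewrite coefZ [_`_ _]nth_default ?mulr0 //.
  move: j0; rewrite -val_eqE /= => j0; have := ltn_ord j => jd.
  case E : (d - j + (j - d))%N => [|m]; first by rewrite size_poly0.
  by rewrite (leq_trans (lucas_poly _ _ _).1) //; lia.
rewrite coef_sum big1 // => j _; rewrite coefZ.
move: kd; rewrite -val_eqE /= => kd; have := ltn_ord k => kd'; have := ltn_ord j => jd.
have [k0|k0] := eqVneq (k : nat) 0%N.
  by rewrite /bezout_coef k0 P0 mul0r mulr0 !mul0r.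
rewrite [_`_ _]nth_default ?mulr0 //.
case E : (k - j + (j - k))%N => [|m]; first by rewrite size_poly0.
by rewrite (leq_trans (lucas_poly _ _ _).1) //; lia.
Qed.

(** This point is the origin, the pole of the line at infinity, so [n = 0] and again only [k = d],
    [j = 0] contributes. *)
Lemma bezout_form_infinity w : bezout_form (hcoord 0 0 w) = (2 * w) ^+ d.-1.
Proof.
have n0 : ncoord (hcoord 0 0 w) = 0 by rewrite /ncoord !hcoordE.
have N0 : nsqr (hcoord 0 0 w) = 0 by rewrite /nsqr !hcoordE; ring.
have c0 k j : (0 < j)%N -> (0 < k)%N -> bezout_coef 0 k j = 0.
  by move=> j0 k0; rewrite /bezout_coef [0 ^+ minn _ _]expr0n; case: eqP => [|_]; [lia|rewrite mulr0 mul0r].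
have c1 k j : (j < d)%N -> (k < d)%N -> bezout_coef 0 k j = 0.
  move=> j0 k0; rewrite /bezout_coef conjc0 [0 ^+ (d - _)]expr0n; case: eqP => [|_]; [lia|by rewrite mulr0].
rewrite /bezout_form n0 N0 hcoordE (bigD1 ord_max) //= [X in _ + X]big1 ?addr0 => [|k kd].
  rewrite (bigD1 ord0) //= [X in _ + X]big1 ?addr0 => [|j j0].
    rewrite /bezout_coef min0n max0n subnn Pd Q0 /= !mulr1 mul1r subn0 addn0.
    by rewrite -[X in lucas _ _ X](prednK d0) lucas_zero; ring.
  by rewrite c0 ?mul0r //; move: j0; rewrite -val_eqE /=; lia.
rewrite big1 // => j _; move: kd; rewrite -val_eqE /= => kd.
have := ltn_ord k => kd'; have := ltn_ord j => jd.
have [k0|k0] := eqVneq (k : nat) 0%N.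
  by rewrite /bezout_coef k0 P0 mul0r mulr0 !mul0r.
have [j0|j0] := eqVneq (j : nat) 0%N; last by rewrite c0 ?mul0r //; lia.
by rewrite c1 ?mul0r //; lia.
Qed.

End Bezoutian.

(** * Derivatives of polynomials along curves *)

Section ChainRule.
Variable R : realType.

Lemma is_derive_meval n (G : mpoly n R) (c : R -> 'I_n -> R) (dc : 'I_n -> R) t :
  (forall i, is_derive t (1 : R) (fun s => c s i) (dc i)) ->
  is_derive t (1 : R) (fun s => meval (c s) G)
    (\sum_i meval (c t) (mderiv i G) * dc i).
Proof.
move=> hc; pose P G := is_derive t (1 : R) (fun s => meval (c s) G)
    (\sum_i meval (c t) (mderiv i G) * dc i).
have PC a : P (mpolyC n a).
  rewrite /P (_ : (fun s => _) = cst a); last by apply/funext => s; rewrite mevalC.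
  by apply: is_derive_eq; rewrite big1 // => i _; rewrite mderivC meval0 mul0r.
have PX i : P (mpolyX R (mnm1 i)).
  rewrite /P (_ : (fun s => _) = (fun s => c s i)); last by apply/funext => s; rewrite mevalXU.
  apply: is_derive_eq (hc i) _; rewrite (bigD1 i) //= big1 ?addr0.
    have -> : mderiv i (mpolyX R (mnm1 i)) = 1.
      rewrite mderivX mnm1E eqxx scale1r -mpolyX0; congr mpolyX.
      by apply/mnmP => j; rewrite mnmBE subnn mnm0E.
    by rewrite meval1 mul1r.
  by move=> j ji; rewrite mderivX mnm1E eq_sym (negbTE ji) scale0r meval0 mul0r.
have PD p q : P p -> P q -> P (p + q).
  rewrite /P => hp hq; rewrite (_ : (fun s => meval (c s) (p + q)) =
    (fun s => meval (c s) p) + (fun s => meval (c s) q)); last first.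
    by apply/funext => s; rewrite mevalD.
  apply: is_derive_eq; rewrite -big_split; apply: eq_bigr => i _.
  by rewrite mderivD mevalD mulrDl.
have PM p q : P p -> P q -> P (p * q).
  rewrite /P => hp hq; rewrite (_ : (fun s => meval (c s) (p * q)) =
    (fun s => meval (c s) p) * (fun s => meval (c s) q)); last first.
    by apply/funext => s; rewrite mevalM.
  apply: is_derive_eq; rewrite /GRing.scale /= !mulr_sumr -big_split; apply: eq_bigr => i _.
  by rewrite mderivM mevalD !mevalM /=; ring.
have PE p k : P p -> P (p ^+ k).
  by move=> hp; elim: k => [|k ih]; [exact: PC|rewrite exprS; exact: PM].
suff : P G by [].
rewrite [G]mpolyE; apply: (big_ind P); [by rewrite -mpolyC0; exact: PC|exact: PD|].
move=> m _; rewrite -mul_mpolyC; apply: (PM); first exact: PC.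
rewrite mpolyXE_id; apply: (big_ind P); [exact: PC|exact: PM|].
by move=> i _; exact: PE.
Qed.

Lemma is_derive_near0 (f : R -> R) t (D : R) :
  is_derive t (1 : R) f D -> (\forall s \near t, f s = 0) -> D = 0.
Proof.
move=> hD hf; have h0 := is_derive_cst (0 : R) t (1 : R).
have h1 : is_derive t (1 : R) (cst 0) D.
  by apply: near_eq_is_derive hD; near=> s; near: s.
by rewrite -[LHS](@derive_val _ _ _ _ _ _ _ h1) (@derive_val _ _ _ _ _ _ _ h0).
Unshelve. all: by end_near. Qed.

(** Places the velocity of a curve drawn on [D] in the Zariski tangent space. *)
Lemma vanishing_derive (D : set 'rV[R]_3) (G : mpoly 3 R) (c : R -> 'rV[R]_3) (dc : 'rV[R]_3) t :
  vanishes_on G D -> (\forall s \near t, D (c s)) ->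
  (forall i, is_derive t (1 : R) (fun s => c s 0 i) (dc 0 i)) ->
  \sum_(i < 3) meval (fun j => c t 0 j) (mderiv i G) * dc 0 i = 0.
Proof.
move=> hG hD hc; have := @is_derive_meval _ G (fun s i => c s 0 i) (fun i => dc 0 i) t hc.
move=> /is_derive_near0; apply; near=> s; apply: hG; near: s; exact: hD.
Unshelve. all: by end_near. Qed.

End ChainRule.

(** * Numerator and denominator of the Blaschke product *)

Section BlaschkePolynomials.
Variables (R : realType) (n : nat) (a : 'I_n -> R[i]).
Local Notation C := R[i].
Hypothesis ha : forall k, `|a k| < 1.

Definition blaschke_num : {poly C} := 'X * \prod_(k < n) ('X - (a k)%:P).
Definition blaschke_den : {poly C} := \prod_(k < n) (1 - (a k)^*%C *: 'X).

Lemma norm_conjc (z : C) : `|z^*%C| = `|z|.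
Proof. by case: z => x y; rewrite !normc_def /= sqrrN. Qed.

Lemma mobius_den_neq0 k (z : C) : `|z| = 1 -> 1 - (a k)^*%C * z != 0.
Proof.
move=> z1; apply/eqP => /subr0_eq /(congr1 Num.norm).
by rewrite normr1 normrM norm_conjc z1 mulr1 => e; have := ha k; rewrite -e ltxx.
Qed.

Lemma blaschke_den_neq0 (z : C) : `|z| = 1 -> blaschke_den.[z] != 0.
Proof.
move=> z1; rewrite /blaschke_den horner_prod; apply/prodf_neq0 => k _.
by rewrite !hornerE mobius_den_neq0.
Qed.

Lemma blaschke_frac (z : C) : blaschke a z = blaschke_num.[z] / blaschke_den.[z].
Proof.
rewrite /blaschke /blaschke_num /blaschke_den hornerM hornerX !horner_prod.
rewrite -mulrA -prodf_div; congr (_ * _); apply: eq_bigr => k _.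
by rewrite !hornerE.
Qed.

Lemma size_blaschke_num : size blaschke_num = n.+2.
Proof.
rewrite /blaschke_num size_monicM ?monicX ?monic_neq0 ?monic_prod_XsubC //.
by rewrite size_polyX size_prod_XsubC /= /index_enum -enumT size_enum_ord.
Qed.

Lemma coef0_blaschke_num : blaschke_num`_0 = 0.
Proof. by rewrite /blaschke_num coefXM. Qed.

Lemma lead_blaschke_num : blaschke_num`_n.+1 = 1.
Proof.
have : blaschke_num \is monic by rewrite monicMl ?monicX ?monic_prod_XsubC.
by move/monicP; rewrite lead_coefE size_blaschke_num.
Qed.

Lemma size_blaschke_den : (size blaschke_den <= n.+2)%N.
Proof.
rewrite (leq_trans (size_poly_prod_leq _ _)) // card_ord.
have : (\sum_(k < n) size (1 - (a k)^*%C *: 'X : {poly C})%R <= \sum_(k < n) 2)%N.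
  apply: leq_sum => k _; rewrite (leq_trans (size_polyD _ _)) // geq_max size_poly1.
  by rewrite size_polyN (leq_trans (size_scale_leq _ _)) // size_polyX.
rewrite sum_nat_const card_ord => h.
by rewrite leq_subLR addnS ltnS (leq_trans h) //; lia.
Qed.

Lemma coef0_blaschke_den : blaschke_den`_0 = 1.
Proof.
by rewrite -horner_coef0 horner_prod big1 // => k _; rewrite !(hornerE, mulr0, subr0).
Qed.

(* Vieta's formulas for [n^* X^2 - 2 v_2 X + n], where [n] is [ncoord v]. *)
Lemma chord_sum_prod (v : 'rV[R]_3) (z w : C) : `|z| = 1 -> `|w| = 1 -> z != w ->
  incident (pole v) (hpoint z) -> incident (pole v) (hpoint w) ->
  (ncoord v)^*%C * (z + w) = (2 * v 0 2)%:C%C /\ (ncoord v)^*%C * (z * w) = ncoord v.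
Proof.
move=> z1 w1 zw; rewrite !incidentE !hcoordE !mulr1.
(* The equation of the line is multiplied by [2 u]; as [|u| = 1], the conjugate of [u] times [u] is
   1 and a quadratic equation results. *)
have quad (u : C) : `|u| = 1 ->
    v 0 0 * complex.Re u + v 0 1 * complex.Im u - v 0 2 = 0 ->
    (ncoord v)^*%C * u ^+ 2 - (2 * v 0 2)%:C%C * u + ncoord v = 0.
  case: u => x y /norm_complex_eq1 /= xy /eqP; rewrite subr_eq0 => /eqP <-.
  have e : ncoord v = ncoord v * (x ^+ 2 + y ^+ 2)%:C%C by rewrite xy mulr1.
  by rewrite [X in _ + X]e /ncoord expr2; apply: complexP => /=; ring.
move=> /(quad _ z1) qz /(quad _ w1) qw.
have zw0 : z - w != 0 by rewrite subr_eq0.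
(* The difference of the two quadratic equations is divisible by [z - w]. *)
have e : (ncoord v)^*%C * (z + w) = (2 * v 0 2)%:C%C.
  apply: (mulfI zw0); apply/eqP; rewrite -subr_eq0; apply/eqP.
  by rewrite -[RHS](subrr 0) -{1}qz -qw; ring.
split=> //; apply/eqP; rewrite -subr_eq0 -oppr_eq0; apply/eqP; rewrite -qz -e; ring.
Qed.

End BlaschkePolynomials.

(** * Smoothness of the exterior curve *)

Section ExteriorEquation.
Variables (R : realType) (n : nat) (a : 'I_n -> R[i]).
Local Notation C := R[i].
Local Notation B := (blaschke a).
Hypothesis ha : forall k, `|a k| < 1.

Definition exterior_form := bezout_form n.+1 (blaschke_num a) (blaschke_den a).

Lemma exterior_form_eq0 v : exterior_curve B v -> exterior_form v = 0.
Proof.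
move=> /exterior_curveP [lam [_ [_ [z [w [[z1 Bz] [w1 Bw] zw iz iw]]]]]].
have [h1 h2] := chord_sum_prod z1 w1 zw iz iw.
apply: (bezout_form_eq0 _ _ zw h1 h2).
- by rewrite size_blaschke_num.
- exact: size_blaschke_den.
apply/eqP; rewrite -eqr_div ?blaschke_den_neq0 // -!blaschke_frac.
by rewrite [blaschke a z]Bz [blaschke a w]Bw.
Qed.

Lemma exists_polar (x y : R) : (x != 0) || (y != 0) ->
  exists r al, [/\ 0 < r, x = r * cos al & y = r * sin al].
Proof.
move=> xy0; pose r := Num.sqrt (x ^+ 2 + y ^+ 2).
have s0 : 0 < x ^+ 2 + y ^+ 2.
  by rewrite lt_neqAle addr_ge0 ?sqr_ge0 // andbT eq_sym paddr_eq0 ?sqr_ge0 // !sqrf_eq0 negb_and.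
have r0 : 0 < r by rewrite sqrtr_gt0.
have [|al alE] := @expi_surj R ((x / r) +i* (y / r))%C.
  apply/norm_complex_eq1; rewrite /= !expr_div_n -mulrDl sqr_sqrtr ?divff ?gt_eqF //.
  exact: ltW.
exists r, al; by split=> //; case: alE => e1 e2; rewrite -?e1 -?e2 mulrC divfK ?gt_eqF.
Qed.

Lemma expiD2pin t k : expi (t + pi *+ 2 *+ k) = expi t :> C.
Proof.
by rewrite /expi (periodicn (@cosD2pi R)) (periodicn (@sinD2pi R)).
Qed.

Lemma expi_pm_neq (al be : R) : 0 < be < pi -> expi (al + be) != expi (al - be) :> C.
Proof.
move=> /sin_gt0_pi sb; apply/eqP => /(congr1 (fun z => expi (- al) * z)).
rewrite -!expiD !addKr => -[_]; rewrite sinN; lra.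
Qed.

(* As [be] increases from [0] to [pi], [psi (al + be) - psi (al - be)] increases
   from [0] to [2 pi (n + 1)]; it is a multiple of [2 pi] when the chord joining
   the points of angles [al + be] and [al - be] has its ends in the same fiber. *)
Lemma exists_exterior_points (r al : R) : 0 < r -> exists be : 'I_n -> R,
  [/\ forall k, 0 < be k < pi, injective be
    & forall k, exterior_curve B (hcoord (r * cos al) (r * sin al) (r * cos (be k)))].
Proof.
move=> r0; have [psi hpsi] := blaschke_lift ha; have [hB _ hper] := hpsi.
have pi0 := pi_gt0 R.
pose D be := psi (al + be) - psi (al - be).
have D0 : D 0 = 0 by rewrite /D addr0 subr0 subrr.
have Dpi : D pi = pi *+ 2 *+ n.+1.
  rewrite /D; have -> : al + pi = (al - pi) + pi *+ 2 by ring.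
  by rewrite hper [psi _ + _]addrC addrK mulr_natr.
have cD : continuous D.
  have cpsi := circle_lift_continuous hpsi.
  move=> x; apply: cvgB; apply: continuous_comp; try exact: cpsi.
    by apply: cvgD; [exact: cvg_cst|exact: cvg_id].
  by apply: cvgB; [exact: cvg_cst|exact: cvg_id].
(* The levels [2 pi (k + 1)] with [k < n] lie strictly between the end values of [D], which excludes
   [0] and [pi]. *)
have hbe (k : 'I_n) : exists be, 0 < be < pi /\ D be = pi *+ 2 *+ k.+1.
  have p2 : 0 < (pi : R) *+ 2 by rewrite mulrn_wgt0.
  have k1 : 0 < pi *+ 2 *+ k.+1 :> R by rewrite mulrn_wgt0.
  have k2 : pi *+ 2 *+ k.+1 < pi *+ 2 *+ n.+1 :> R by rewrite ltr_pMn2l // ltnS.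
  have [] := @IVT _ D 0 pi (pi *+ 2 *+ k.+1) (ltW pi0).
  - by apply: continuous_subspaceT; exact: cD.
  - by rewrite D0 Dpi ge_min le_max (ltW k1) (ltW k2) orbT.
  move=> be; rewrite in_itv /= => /andP[b0 b1] Db; exists be; split=> //.
  rewrite !lt_neqAle b0 b1 !andbT; apply/andP; split; apply/eqP => e.
    by move: Db k1; rewrite -e D0 => <-; rewrite ltxx.
  by move: Db k2; rewrite e Dpi => <-; rewrite ltxx.
have [be hbe'] := choice hbe; exists be; split=> [k|k l e|k].
- by have [] := hbe' k.
- have p2 : (pi : R) *+ 2 != 0 by rewrite gt_eqF // mulrn_wgt0.
  apply/val_inj/succn_inj/(mulrIn p2).
  by have [_ <-] := hbe' k; have [_ <-] := hbe' l; rewrite e.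
have [bk hk] := hbe' k; apply/exterior_curveP.
(* The chord joining these two ends has equation [x cos al + y sin al = cos (be k)]. *)
exists (B (expi (al + be k))); split; first by rewrite hB norm_expi.
split.
  rewrite pole_eq0; apply/eqP => /rowP h; move: (h 0) (h 1); rewrite !hcoordE !mxE => h0 h1.
  by have := cos2Dsin2 al; nra.
exists (expi (al + be k)), (expi (al - be k)); split.
- by split=> //; exact: norm_expi.
- split; first exact: norm_expi.
  by rewrite !hB; move: hk => /(canRL (subrK _)) ->; rewrite [_ *+ k.+1 + _]addrC expiD2pin.
- exact: expi_pm_neq.
- rewrite incidentE !hcoordE /= cosD sinD; have := cos2Dsin2 al.
  set c := cos al; set s := sin al => cs.
  by transitivity (r * cos (be k) * (c ^+ 2 + s ^+ 2 - 1)); [ring|rewrite cs subrr mulr0].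
- rewrite incidentE !hcoordE /= cosB sinB; have := cos2Dsin2 al.
  set c := cos al; set s := sin al => cs.
  by transitivity (r * cos (be k) * (c ^+ 2 + s ^+ 2 - 1)); [ring|rewrite cs subrr mulr0].
Qed.

Lemma exterior_equation : exists G : mpoly 3 R,
  [/\ homogeneous G, vanishes_on G (exterior_curve B)
    & forall v : 'rV[R]_3, v != 0 -> meval (fun i => v 0 i) G = 0 ->
      exterior_curve B v /\ meval (fun i => v 0 i) (mderiv 2 G) != 0].
Proof.
have sP : (size (blaschke_num a) <= n.+2)%N by rewrite size_blaschke_num.
have sQ := size_blaschke_den a.
have [G hG GE] := bezout_form_is_form sP sQ.
exists G; split; [by exists n|by move=> v Ev; rewrite GE; exact: exterior_form_eq0|].
move=> v v0 Gv; pose x := v 0 0; pose y := v 0 1; pose w := v 0 2.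
have vE : v = hcoord x y w by apply: eq_row3; rewrite !hcoordE.
have P0 := coef0_blaschke_num a; have P1 := lead_blaschke_num a.
have Q0 := coef0_blaschke_den a.
(* The second case is the origin, where the form does not vanish. *)
have [xy0|] := boolP ((x != 0) || (y != 0)); last first.
  rewrite negb_or !negbK => /andP[/eqP x0 /eqP y0].
  move: Gv; rewrite GE vE x0 y0 bezout_form_infinity //= => /eqP.
  rewrite expf_eq0 mulf_eq0 pnatr_eq0 /= => /andP[_ /eqP w0].
  by case/eqP: v0; rewrite vE x0 y0 w0; apply: eq_row3; rewrite hcoordE mxE.
have [r [al [r0 xE yE]]] := exists_polar xy0.
have [be [be_itv be_inj Ebe]] := exists_exterior_points al r0.
rewrite -xE -yE in Ebe.
have [p [pE sp cp]] := bezout_form_poly sP sQ (ltn0Sn n) P0 P1 Q0 x y.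
pose rs := [seq r * cos (be k) | k <- enum 'I_n].
have urs : uniq rs.
  rewrite map_inj_uniq ?enum_uniq // => k l /(mulfI (lt0r_neq0 r0)) e.
  by apply/be_inj/cos_inj => //; rewrite in_itv /=; apply/andP; split; apply: ltW;
    [have /andP[] := be_itv k|have /andP[] := be_itv k|have /andP[] := be_itv l|have /andP[] := be_itv l].
have rrs : all (root p) rs.
  by apply/allP => _ /mapP[k _ ->]; rewrite /root pE; apply/eqP/exterior_form_eq0/Ebe.
(* The coefficient of index [n] is a power of 2, so the degree is exactly [n] and the known roots
   exhaust [p]. *)
have sp' : size p = (size rs).+1.
  rewrite size_map size_enum_ord; apply/eqP; rewrite eqn_leq sp /= ltnNge.
  by apply/negP => /(nth_default 0) /eqP; rewrite cp expf_eq0 pnatr_eq0 andbF.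
have pF := all_roots_prod_XsubC sp' rrs; rewrite uniq_rootsE in pF; have {}pF := pF urs.
set c := lead_coef p in pF.
have c0 : c != 0 by rewrite lead_coef_eq0 -size_poly_gt0 sp'.
have rw : root p w by rewrite /root pE -vE -GE Gv.
have : root (\prod_(z <- rs) ('X - z%:P)) w by move: rw; rewrite pF rootZ.
rewrite root_prod_XsubC => wrs; split.
  by move/mapP: wrs => [k _ wE]; rewrite vE wE; exact: Ebe.
have dG : is_derive w (1 : R) (horner p) (meval (fun i => v 0 i) (mderiv 2 G)).
  have := @is_derive_meval _ _ G (fun s i => hcoord x y s 0 i)
     (fun i => hcoord 0 0 1 0 i) w.
  rewrite -vE (_ : (fun s => meval _ G) = horner p); last first.
    by apply/funext => s; rewrite pE GE.
  rewrite sum_ord3 !hcoordE !mulr0 mulr1 !add0r; apply.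
  apply: forall_ord3.
  - rewrite (_ : (fun s => _) = cst x); last by apply/funext => s; rewrite hcoordE.
    by rewrite hcoordE; exact: is_derive_cst.
  - rewrite (_ : (fun s => _) = cst y); last by apply/funext => s; rewrite hcoordE.
    by rewrite hcoordE; exact: is_derive_cst.
  - rewrite (_ : (fun s => _) = id); last by apply/funext => s; rewrite hcoordE.
    by rewrite hcoordE; exact: is_derive_id.
have -> : meval (fun i => v 0 i) (mderiv 2 G) = p^`().[w].
  by rewrite -[LHS](@derive_val _ _ _ _ _ _ _ dG) -derive1E derivE.
rewrite pF derivZ hornerZ mulf_neq0 //.
have : separable_poly (\prod_(z <- rs) ('X - z%:P)) by rewrite separable_prod_XsubC.
rewrite unlock => /coprimep_root; apply.
by rewrite root_prod_XsubC.
Qed.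

(** The single form of [exterior_equation] already cuts out the curve, so no point is added. *)
Lemma homogenization_exterior : homogenization (exterior_curve B) = exterior_curve B.
Proof.
have [G [hG vG GE]] := exterior_equation.
(* In [homogenization] the nonvanishing bears on the coefficient function of the vector. *)
have fun0 : fun_of_matrix (0 : 'rV[R]_3) = 0.
  by apply/funext => i; apply/funext => j; rewrite mxE.
apply/seteqP; split=> v.
  move=> [v0 h]; have [|//] := GE v _ (h G hG vG).
  by apply: contra_neq v0 => ->.
move=> Ev; split=> [|F _]; last exact.
case: Ev => + _; apply: contra_neq => v0; apply: eq_row3;
  by rewrite [fun_of_matrix v]v0 mxE.
Qed.

End ExteriorEquation.

(** * Independence of a chord and its derivative *)

Section Independence.
Variables (R : realType) (n : nat) (a : 'I_n -> R[i]).
Local Notation C := R[i].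
Local Notation B := (blaschke a).
Hypothesis ha : forall k, `|a k| < 1.

(** Unimodularity is included to make the class stable under products. *)
Definition circle_lipschitz (f : C -> C) :=
  (forall z, `|z| = 1 -> `|f z| = 1) /\
  exists2 K : C, 0 <= K & forall z w, `|z| = 1 -> `|w| = 1 ->
    `|f z - f w| <= K * `|z - w|.

Lemma circle_lipschitzM f g : circle_lipschitz f -> circle_lipschitz g ->
  circle_lipschitz (fun z => f z * g z).
Proof.
move=> [f1 [K K0 fK]] [g1 [M M0 gM]]; split=> [z z1|].
  by rewrite normrM f1 // g1 // mulr1.
exists (K + M); first exact: addr_ge0.
move=> z w z1 w1; have -> : f z * g z - f w * g w = (f z - f w) * g z + f w * (g z - g w).
  by ring.
rewrite (le_trans (ler_normD _ _)) // !normrM g1 // f1 // mulr1 mul1r mulrDl.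
by rewrite lerD // ?fK ?gM.
Qed.

(** The difference of two values is [(1 - b * a k) * (z - w)] over a product of two denominators,
    each of modulus at least [1 - |a k|]. *)
Lemma mobius_lipschitz k : circle_lipschitz (fun z => (z - a k) / (1 - (a k)^*%C * z)).
Proof.
split=> [z z1|].
  have [t ->] := expi_surj z1; have [psi [-> _ _]] := mobius_lift (ha k).
  exact: norm_expi.
set b := (a k)^*%C; pose e := 1 - `|a k|; have e0 : 0 < e by rewrite subr_gt0.
have lb z : `|z| = 1 -> e <= `|1 - b * z|.
  move=> z1; have := lerB_normD 1 (- (b * z)); rewrite normrN normrM z1 mulr1 normr1.
  by rewrite norm_conjc.
exists (`|1 - b * a k| / (e * e)) => [|z w z1 w1]; first by rewrite divr_ge0 // mulr_ge0 // ltW.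
have -> : (z - a k) / (1 - b * z) - (w - a k) / (1 - b * w) =
    (1 - b * a k) * (z - w) / ((1 - b * z) * (1 - b * w)).
  have := mobius_den_neq0 ha k z1; have := mobius_den_neq0 ha k w1.
  by rewrite -/b => h1 h2; field; rewrite h1.
rewrite !normrM normfV normrM mulrAC ler_wpM2r // ler_wpM2l //.
rewrite lef_pV2 ?posrE ?mulr_gt0 ?(lt_le_trans e0 (lb _ _)) //.
by rewrite ler_pM ?lb // ltW.
Qed.

Lemma blaschke_lipschitz : exists2 K : C, 0 < K & forall z w, `|z| = 1 -> `|w| = 1 ->
    `|B z - B w| <= K * `|z - w|.
Proof.
suff [_ [K K0 hK]] : circle_lipschitz B.
  exists (K + 1); first by rewrite ltr_wpDl.
  move=> z w z1 w1; rewrite (le_trans (hK _ _ z1 w1)) // ler_wpM2r //.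
  by rewrite lerDl.
apply: circle_lipschitzM.
  by split=> // ; exists 1 => // z w _ _; rewrite mul1r.
elim: (index_enum _) => [|k r ih].
  split=> [z _|]; first by rewrite big_nil normr1.
  by exists 0 => // z w _ _; rewrite !big_nil subrr normr0 mul0r.
rewrite (_ : (fun z => _) = fun z => (z - a k) / (1 - (a k)^*%C * z) *
  \prod_(j <- r) ((z - a j) / (1 - (a j)^*%C * z))).
  by apply: circle_lipschitzM ih; exact: mobius_lipschitz.
by apply/funext => z; rewrite big_cons.
Qed.

Lemma norm_ge_Im (z : C) : (`|complex.Im z|)%:C%C <= `|z|.
Proof.
rewrite normc_def lecR -sqrtr_sqr ler_wsqrtr // lerDr.
exact: sqr_ge0.
Qed.

Lemma norm_real (x : R) : `|x%:C%C| = `|x|%:C%C :> C.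
Proof. by rewrite normc_def /= expr0n addr0 sqrtr_sqr. Qed.

(* The distance from a point [z] of the circle to the chord [L] through [z1] and
   [z2] is [|z - z1| |z - z2| / 2]. *)
Lemma chord_distance (L : 'rV[R]_3) (z z1 z2 : C) : `|z| = 1 -> `|z1| = 1 ->
  `|z2| = 1 -> z1 != z2 -> incident L (hpoint z1) -> incident L (hpoint z2) ->
  `|ncoord L| * (`|z - z1| * `|z - z2|) =
   2 * `|L 0 0 * complex.Re z + L 0 1 * complex.Im z + L 0 2|%:C%C.
Proof.
move=> hz h1 h2 z12 i1 i2.
have [] := @chord_sum_prod R (pole L) z1 z2 h1 h2 z12; rewrite ?polekC //.
rewrite !hcoordE; have -> : ncoord (pole L) = ncoord L by rewrite /ncoord !hcoordE.
move=> e1 e2; rewrite -norm_conjc -!normrM -norm_real.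
set F := (_ + L 0 2); have -> : 2 * `|F%:C%C| = `|2 * (z * F%:C%C)| by rewrite !normrM hz mul1r normr_nat.
congr Num.norm.
have -> : (ncoord L)^*%C * ((z - z1) * (z - z2)) =
  (ncoord L)^*%C * z ^+ 2 - (ncoord L)^*%C * (z1 + z2) * z + (ncoord L)^*%C * (z1 * z2) by ring.
rewrite e1 e2; case: z hz @F => x y /norm_complex_eq1 /= xy.
have e : ncoord L = ncoord L * (x ^+ 2 + y ^+ 2)%:C%C by rewrite xy mulr1.
by rewrite [X in _ + X]e /ncoord expr2; apply: complexP => /=; ring.
Qed.

(** By the triangle inequality [|v - w|] is at most the sum of the two distances, and [m] times
    either distance is at most their product. *)
Lemma norm_two_factors (u v w : C) (m : C) : 0 <= m -> m <= `|u - v| -> m <= `|u - w| ->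
  m * `|v - w| <= 2 * (`|u - v| * `|u - w|).
Proof.
move=> m0 h1 h2.
have h : `|v - w| <= `|u - v| + `|u - w|.
  have -> : v - w = (u - w) - (u - v) by ring.
  by rewrite [leRHS]addrC ler_normB.
rewrite (le_trans (ler_wpM2l m0 h)) // mulrDr mulr2n mulrDl mul1r lerD //.
  by rewrite mulrC ler_wpM2l.
by rewrite ler_wpM2r.
Qed.

(* If [l] moved to first order along its own ray, the ends of the chord [l s]
   would be at distance [o(s - t)] from the chord [l t]; but [B] is Lipschitz,
   so they move away from the two ends of [l t] at a positive speed. *)
Lemma chord_velocity (t : R) (l : R -> 'rV[R]_3) (dl : 'rV[R]_3) :
  (\forall s \near t, chord_lines B (expi s) (l s)) ->
  (forall i, is_derive t (1 : R) (fun s => l s 0 i) (dl 0 i)) ->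
  cross dl (l t) != 0.
Proof.
move=> hl hd; apply/eqP.
have [lt0 [z1 [z2 [[h1 b1] [h2 b2] z12 i1 i2]]]] : chord_lines B (expi t) (l t).
  exact: nbhs_singleton hl.
move=> /(cross_eq0_scale lt0) [c dlE].
have [K K0 hK] := blaschke_lipschitz.
(* A chord is not the line at infinity. *)
have n0 : ncoord (l t) != 0.
  apply/eqP => -[x0 y0]; case/eqP: lt0; move: i1; rewrite incidentE !hcoordE x0 y0 !mul0r.
  by rewrite !add0r mulr1 => w0; apply: eq_row3; rewrite mxE.
(* The 4 is the product of the factors 2 in [chord_distance] and [norm_two_factors]; [K] comes from
   the Lipschitz bound. *)
pose kap : C := `|ncoord (l t)| * `|z1 - z2| / (4 * K).
have kap0 : 0 < kap by rewrite divr_gt0 ?mulr_gt0 ?normr_gt0 // subr_eq0.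
have [k kE k0] : exists2 k : R, kap = k%:C%C & 0 < k.
  exists (complex.Re kap); last by move: kap0; rewrite ltcE => /andP[].
  by move: kap0; rewrite ltcE => /andP[/eqP h _]; apply: complexP.
(* For an end [z] of [l s], the value [F] of [l t] at [z] is at least of order [|s - t|], while
   incidence with [l s] bounds it, up to the factor [1 + c * (s - t)], by the deviation of [l s]
   from a multiple of [l t]. *)
have key s : chord_lines B (expi s) (l s) ->
    k * `|sin (s - t) * (1 + c * (s - t))| <=
    \sum_i `|l s 0 i - (1 + c * (s - t)) * l t 0 i|.
  move=> [_ [z [_ [[hz bz] _ _ iz _]]]].
  pose F := l t 0 0 * complex.Re z + l t 0 1 * complex.Im z + l t 0 2.
  have hF : k * `|sin (s - t)| <= `|F|.
    have hs z' : `|z'| = 1 -> B z' = expi t -> (`|sin (s - t)|)%:C%C / K <= `|z - z'|.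
      move=> hz' bz'; rewrite ler_pdivrMr // mulrC (le_trans _ (hK _ _ hz hz')) //.
      rewrite [B z]bz [B z']bz'.
      have -> : expi s - expi t = (expi (s - t) - 1) * expi t :> C.
        by rewrite mulrBl mul1r -expiD subrK.
      rewrite normrM norm_expi mulr1 (le_trans _ (norm_ge_Im _)) //= subr0.
      exact: lexx.
    have m0 : 0 <= (`|sin (s - t)|)%:C%C / K by rewrite divr_ge0 // ?ler0c // ltW.
    have := norm_two_factors m0 (hs _ h1 b1) (hs _ h2 b2).
    move=> /(ler_wpM2l (normr_ge0 (ncoord (l t)))); rewrite [leRHS]mulrCA.
    rewrite (chord_distance hz h1 h2 z12 i1 i2) -/F => h.
    rewrite -lecR rmorphM /= -kE; rewrite -(@ler_pM2l _ 4) //.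
    rewrite (_ : 4 * (`|F|%:C%C) = 2 * (2 * `|F|%:C%C)) ?(le_trans _ h) //; last by ring.
    rewrite le_eqVlt; apply/orP; left; apply/eqP; rewrite /kap; field.
    by rewrite gt_eqF.
  rewrite normrM mulrA (le_trans (ler_wpM2r (normr_ge0 _) hF)) // -normrM.
  have -> : F * (1 + c * (s - t)) = - \sum_i (l s 0 i - (1 + c * (s - t)) * l t 0 i) * hpoint z 0 i.
    move: iz; rewrite incidentE sum_ord3 !hcoordE => e.
    by rewrite -[RHS]addr0 -e /F; ring.
  rewrite normrN (le_trans (ler_norm_sum _ _ _)) // ler_sum // => i _.
  rewrite normrM ler_piMr //.
  have hz2 := (norm_complex_eq1 z).1 hz.
  move: i; apply: forall_ord3; rewrite hcoordE ?normr1 // ler_norml; apply/andP; split; nra.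
have hg : is_derive t (1 : R) (fun s => sin (s - t) * (1 + c * (s - t))) 1.
  apply: is_derive_eq; rewrite /GRing.scale /= subrr cos0 sin0; ring.
(* Proportionality of [dl] and [l t] enters here: the deviation has zero derivative. *)
have he i : is_derive t (1 : R) (fun s => l s 0 i - (1 + c * (s - t)) * l t 0 i) 0.
  have hdi := hd i; have hdc : is_derive t (1 : R) (fun s => (1 + c * (s - t)) * l t 0 i) (c * l t 0 i).
    by apply: is_derive_eq; rewrite /GRing.scale /= subrr; ring.
  by apply: is_derive_eq; rewrite dlE mxE subrr.
have [G [gE cG Gt]] := (is_derive1_caratheodory _ _ _).1 hg.
have [E hE] := choice (fun i => (is_derive1_caratheodory _ _ _).1 (he i)).
have Gnear : \forall s \near t, 1 / 2 < G s.
  by apply: (cvgr_gt _ cG); rewrite Gt; lra.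
(* Three deviations below [k / 8] add up to less than the lower bound [k / 2]. *)
have Enear i : \forall s \near t, `|E i s| < k / 8.
  have [_ cE Et] := hE i; move: cE.
  by rewrite /prop_for /continuous_at Et => /cvgr0_norm_lt; apply; lra.
suff /filter_ex [] : \forall s \near t^', False by [].
near=> s.
have st : 0 < `|s - t| by rewrite normr_gt0 subr_eq0; near: s; exact: nbhs_dnbhs_neq.
have : chord_lines B (expi s) (l s) by near: s; apply: nbhs_dnbhs; exact: hl.
move=> /key; move: (gE s); rewrite subrr sin0 mul0r subr0 => ->.
have eE i : `|l s 0 i - (1 + c * (s - t)) * l t 0 i| = `|E i s| * `|s - t|.
  by have [/(_ s) + _ _] := hE i; rewrite subrr mulr0 addr0 mul1r subrr subr0 => ->; rewrite normrM.
rewrite (eq_bigr _ (fun i _ => eE i)) -mulr_suml normrM mulrA ler_pM2r // sum_ord3.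
apply/negP; rewrite -ltNge.
have hG : 1 / 2 < `|G s|.
  by rewrite (lt_le_trans _ (ler_norm _)) //; near: s; apply: nbhs_dnbhs; exact: Gnear.
have e0 : `|E 0 s| < k / 8 by near: s; apply: nbhs_dnbhs; exact: Enear.
have e1 : `|E 1 s| < k / 8 by near: s; apply: nbhs_dnbhs; exact: Enear.
have e2 : `|E 2 s| < k / 8 by near: s; apply: nbhs_dnbhs; exact: Enear.
by nra.
Unshelve. all: by end_near. Qed.

End Independence.

(** * The dual of the exterior curve *)

Section InteriorExterior.
Variables (R : realType) (n : nat) (a : 'I_n -> R[i]).
Local Notation C := R[i].
Local Notation B := (blaschke a).
Local Notation E := (exterior_curve B).
Hypothesis ha : forall k, `|a k| < 1.

Lemma exterior_curveZ c v : c != 0 -> E v -> E (c *: v).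
Proof.
move=> c0 /exterior_curveP [lam [lam1 [v0 [z [w [hz hw zw iz iw]]]]]].
apply/exterior_curveP; exists lam; split=> //; rewrite poleZ; split.
  by rewrite scaler_eq0 negb_or c0.
by exists z, w; split=> //; apply/incidentC/incidentZr/incidentC.
Qed.

(** Euler's relation, obtained by differentiating along the ray [s *: v], which stays on the curve
    near [s = 1]. *)
Lemma vanishing_derive_ray (G : mpoly 3 R) v : vanishes_on G E -> E v ->
  \sum_(i < 3) meval (fun j => v 0 j) (mderiv i G) * v 0 i = 0.
Proof.
move=> hG Ev; have := @vanishing_derive R E G (fun s => s *: v) v 1 hG.
rewrite scale1r; apply.
  have : \forall s \near (1 : R), 0 < s by apply: lt_nbhsr; exact: ltr01.
  by apply: filterS => s s0; apply: exterior_curveZ => //; rewrite gt_eqF.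
move=> i; rewrite (_ : (fun s => _) = v 0 i \*: id).
  by apply: is_derive_eq; rewrite /GRing.scale /= mulr1.
by apply/funext => s; rewrite mxE /= mulrC.
Qed.

Lemma is_derive_pole t (l : R -> 'rV[R]_3) (dl : 'rV[R]_3) :
  (forall i, is_derive t (1 : R) (fun s => l s 0 i) (dl 0 i)) ->
  forall i, is_derive t (1 : R) (fun s => pole (l s) 0 i) (pole dl 0 i).
Proof.
move=> hd; apply: forall_ord3.
- by rewrite (_ : (fun s => _) = (fun s => l s 0 0)) ?hcoordE //; apply/funext => s; rewrite hcoordE.
- by rewrite (_ : (fun s => _) = (fun s => l s 0 1)) ?hcoordE //; apply/funext => s; rewrite hcoordE.
- rewrite (_ : (fun s => _) = - (fun s => l s 0 2)); last by apply/funext => s; rewrite hcoordE.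
  by have h2 := hd 2; rewrite hcoordE; apply: is_derive_eq.
Qed.

Lemma cross_pole_neq0 (u v : 'rV[R]_3) : cross u v != 0 -> cross (pole v) (pole u) != 0.
Proof.
apply: contra_neq => /rowP h; move: (h 0) (h 1) (h 2).
by rewrite !hcoordE !mxE => h0 h1 h2; apply: eq_row3; rewrite !hcoordE mxE; lra.
Qed.

(** The point of contact is [q = pole (l t)]. The differentials at [q] of the forms vanishing on the
    curve kill [q] and the velocity [pole dl], which are independent, so each is a multiple of the
    line [hpoint (- p)] through both. *)
Lemma interior_sub_dual p : interior_curve B p -> dual_curve E (hpoint (- p)).
Proof.
move=> [t [l [dl [hl hd ip idl]]]].
have hc := is_derive_pole hd.
have Enear : \forall s \near t, E (pole (l s)).
  apply: filterS hl => s ls; apply/exterior_curveP; exists (expi s).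
  by rewrite polekC norm_expi.
have Eq := nbhs_singleton Enear; set q := pole (l t) in Eq.
have cr := cross_pole_neq0 (chord_velocity ha hl hd).
pose L := hpoint (- p); pose grad G : 'rV[R]_3 := \row_i meval (fun j => q 0 j) (mderiv i G).
have gradE G (v : 'rV[R]_3) : \sum_(i < 3) meval (fun j => q 0 j) (mderiv i G) * v 0 i = 0 <->
    incident (grad G) v.
  by rewrite /incident; under [in X in _ <-> X]eq_bigr do rewrite mxE.
have Lq : incident L q by apply/incident_hpointN; rewrite polekC.
have Ld : incident L (pole dl) by apply/incident_hpointN; rewrite polekC.
have gradL G : vanishes_on G E -> exists c, grad G = c *: L.
  move=> vG; apply: (incident2_scale cr (hpoint_neq0 _) Lq Ld); apply/gradE.
    exact: vanishing_derive_ray.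
  exact: vanishing_derive Enear hc.
exists q => //; split=> [|v]; first exact: hpoint_neq0.
split=> [Lv G _ vG|h].
  by have [c gE] := gradL G vG; apply/gradE; rewrite gE; apply/incidentC/incidentZr/incidentC.
(* This form has a nonzero differential at [q], so the common kernel is not larger than the line. *)
have [G [hG vG GE]] := exterior_equation ha.
have q0 : q != 0 by case: Eq.
have [_ d2] := GE q q0 (vG q Eq); have [c gE] := gradL G vG.
have c0 : c != 0.
  apply: contra_neq d2 => c0; have := congr1 (fun r : 'rV[R]_3 => r 0 2) gE.
  by rewrite c0 scale0r !mxE.
have /gradE := h G hG vG; rewrite gE => /incidentC /(incidentZr c^-1).
by rewrite scalerA mulVf // scale1r => /incidentC.
Qed.

(** Both ends follow the fiber by [circle_lift_section]; the constant factor [k] makes the cross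
    product of the ends equal to [L] at [t]. *)
Lemma chord_section t L : chord_lines B (expi t) L -> exists (l : R -> 'rV[R]_3) (dl : 'rV[R]_3),
  [/\ l t = L, \forall s \near t, chord_lines B (expi s) (l s)
    & forall i, is_derive t (1 : R) (fun s => l s 0 i) (dl 0 i)].
Proof.
move=> [L0 [z [w [[z1 Bz] [w1 Bw] zw iz iw]]]].
have [psi hpsi] := blaschke_lift ha.
have [al zE] := expi_surj z1; have [be wE] := expi_surj w1.
have n0 : 0 < n.+1%:R :> R by rewrite ltr0Sn.
have hal : B (expi al) = expi t by rewrite -zE [LHS]Bz.
have hbe : B (expi be) = expi t by rewrite -wE [LHS]Bw.
have [th [d [tht dth Bth]]] := circle_lift_section hpsi n0 hal.
have [ph [e [pht dph Bph]]] := circle_lift_section hpsi n0 hbe.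
have [k LE] := incident_cross (cross_hpoint_neq0 zw) iz iw.
have k0 : k != 0 by apply: contra_neq L0 => k0; rewrite LE k0 scale0r.
pose l s := k *: cross (hpoint (expi (th s))) (hpoint (expi (ph s))).
have lt : l t = L by rewrite /l tht pht -zE -wE -LE.
have dcomp (f f' g : R -> R) (g' : R) : (forall x, is_derive x (1 : R) f (f' x)) ->
    is_derive t (1 : R) g g' -> derivable (f \o g) t 1.
  by move=> hf hg; case: (is_derive1_comp (hf (g t)) hg).
have dl i : derivable (fun s => l s 0 i) t 1.
  have d1 := dcomp _ _ _ _ (@is_derive_cos R) dth.
  have d2 := dcomp _ _ _ _ (@is_derive_sin R) dth.
  have d3 := dcomp _ _ _ _ (@is_derive_cos R) dph.
  have d4 := dcomp _ _ _ _ (@is_derive_sin R) dph.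
  have dlin (f g : R -> R) : derivable f t 1 -> derivable g t 1 ->
      derivable (k \*: (f - g)) t 1.
    by move=> df dg; apply/derivableZ/derivableB.
  move: i; apply: forall_ord3.
  - rewrite (_ : (fun s => _) = k \*: ((sin \o th) - (sin \o ph))); first exact: (dlin _ _ d2 d4).
    by apply/funext => s; rewrite mxE !hcoordE /= mulr1 mul1r.
  - rewrite (_ : (fun s => _) = k \*: ((cos \o ph) - (cos \o th))); first exact: (dlin _ _ d3 d1).
    by apply/funext => s; rewrite mxE !hcoordE /= mulr1 mul1r.
  - rewrite (_ : (fun s => _) = k \*: ((cos \o th) * (sin \o ph) - (sin \o th) * (cos \o ph))).
      exact: (dlin _ _ (derivableM d1 d4) (derivableM d2 d3)).
    by apply/funext => s; rewrite mxE !hcoordE /=.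
exists l, (\row_i 'D_1 (fun s => l s 0 i) t); split=> // [|i]; last first.
  by rewrite mxE; apply/derivableP.
(* A coordinate that is nonzero at [t] stays so nearby, which keeps [l s] nonzero and its two ends
   distinct. *)
have [i Li] : exists i, L 0 i != 0.
  apply: contrapT => /forallNP hv; case/eqP: L0; apply/rowP => i.
  by rewrite mxE; apply/eqP/negPn/negP/hv.
have near0 : \forall s \near t, l s 0 i != 0.
  have cl : {for t, continuous (fun s => l s 0 i)}.
    exact/differentiable_continuous/derivable1_diffP.
  by apply: (cvgr_neq0 _ cl); rewrite lt.
apply: filterS near0 => s ls0.
have l0 : l s != 0 by apply: contra_neq ls0 => ->; rewrite mxE.
split=> //; exists (expi (th s)), (expi (ph s)); split.
- by split=> //; exact: norm_expi.
- by split=> //; exact: norm_expi.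
- apply: contra_neq l0 => e0; rewrite /l e0; apply: eq_row3; rewrite !mxE /=; ring.
- apply/incidentC/incidentZr/incidentC; exact: incident_crossl.
- apply/incidentC/incidentZr/incidentC; exact: incident_crossr.
Qed.

(** The Zariski tangent space at [q] contains [q] and the velocity of the pole of a chord family
    through it; these two incidences are the equations of the envelope. *)
Lemma dual_sub_interior p : dual_curve E (hpoint (- p)) -> interior_curve B p.
Proof.
move=> [q Eq [_ tan]].
have [lam [lam1 hq]] := (exterior_curveP _ _).1 Eq.
have [t lamE] := expi_surj lam1; rewrite lamE in hq.
have [l [dl [lt hl hd]]] := chord_section hq.
exists t, l, dl; split=> //.
- rewrite lt; apply/incident_hpointN/tan => G _ vG; exact: vanishing_derive_ray.
- rewrite -[dl]polekC; apply/incident_hpointN/tan => G _ vG.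
  have Enear : \forall s \near t, E (pole (l s)).
    apply: filterS hl => s ls; apply/exterior_curveP; exists (expi s).
    by rewrite polekC norm_expi.
  have := vanishing_derive vG Enear (is_derive_pole hd).
  by rewrite lt polekC.
Qed.

Lemma interior_curveE :
  interior_curve B = [set p | affine_part (dual_curve (homogenization E)) (- p)].
Proof.
rewrite homogenization_exterior //; apply/seteqP; split=> p.
  exact: interior_sub_dual.
exact: dual_sub_interior.
Qed.

End InteriorExterior.

Theorem theorem5 (R : realType) (d : nat) (hd : (0 < d)%N)
    (a : 'I_d.-1 -> R[i]) (ha : forall k, `|a k| < 1) (u : mpoly 2 R) :
  let B := blaschke a in
  let E_dual := affine_part (dual_curve (homogenization (exterior_curve B))) in
  (equation_of (peval u) E_dual ->
     equation_of (fun z => peval u (- z)) (interior_curve B))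
  /\
  (algebraic_equation_of (peval u) E_dual ->
     algebraic_equation_of (fun z => peval u (- z)) (interior_curve B)).
Proof.
move=> B E_dual; rewrite (interior_curveE ha) -/B -/E_dual.
split=> [|]; first by rewrite /equation_of => ->.
by rewrite /algebraic_equation_of zariski_closureN => ->.
Qed.
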